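(* Let $b \geq 3$ be an integer and let $D \subset \{0,1,\ldots,b-1\}$ with $2 \leq \#D \leq b-1$, such that $D$ contains at least one of $0$ and $b-1$. Let $C(b,D)$ be the corresponding generalized Cantor set, with Hausdorff dimension $\gamma = \log\#D/\log b$. Let $t \geq 2$ be an integer which is multiplicatively dependent with $b$ (i.e. $\log t/\log b \in \mathbb{Q}$). Let $f$ be a dimension function such that $r \mapsto r^{-\gamma} f(r)$ is monotonic, and let $\psi : \mathbb{N} \to (0,\infty)$ be any function. Then $$\mathcal{H}^{f} (W_{t}(\psi) \cap C(b,D)) = \begin{cases} 0, &\text{ if } \sum_{n=1}^{\infty} f(\psi(n))\, t^{n \gamma} < \infty, \\ \mathcal{H}^{f}(C(b,D)), &\text{ if } \sum_{n=1}^{\infty} f(\psi(n))\, t^{n \gamma} = \infty. \end{cases}$$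
   Context: The generalized Cantor set $C(b,D)$ is the set of real numbers $x \in [0,1]$ whose base-$b$ expansion uses only digits from $D$. A dimension function is a continuous, non-decreasing function $f:(0,\infty)\to(0,\infty)$ with $\lim_{r\to 0} f(r)=0$; $\mathcal{H}^f$ is the Hausdorff $f$-measure. For an integer $t\ge 2$ and $\psi:\mathbb{N}\to(0,\infty)$, $W_{t}(\psi) = \{x \in [0,1] : |x - p/t^n| < \psi(n) \text{ for infinitely many } (p,n) \in \mathbb{N}^2\}$. *)

(* Defs.v *)
From HB Require Import structures.
From mathcomp Require Import all_boot all_order all_algebra.
From mathcomp Require Import all_classical all_reals all_analysis.
Set Implicit Arguments.
Unset Strict Implicit.
Unset Printing Implicit Defensive.
Import Order.TTheory GRing.Theory Num.Theory.
Import numFieldNormedType.Exports.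
Local Open Scope classical_set_scope.
Local Open Scope ring_scope.

Section Defs.
Variable R : realType.

(* diameter of a subset of R (extended real; diam set0 = -oo) *)
Definition diam (U : set R) : \bar R :=
  ereal_sup [set (`|x - y|)%:E | x in U & y in U].

(* cost f(diam U) of a covering set; f is extended by 0 at non-positive
   arguments (sets of diameter 0 or empty sets cost nothing). *)
Definition cover_cost (f : R -> R) (U : set R) : R :=
  if (0%E < diam U)%E then f (fine (diam U)) else 0.

Definition hausdorff_content (f : R -> R) (delta : R) (A : set R) : \bar R :=
  ereal_inf [set (\sum_(0 <= i <oo) (cover_cost f (U i))%:E)%E
            | U in [set U : nat -> set R |
                    (forall i, (diam (U i) <= delta%:E)%E) /\
                    A `<=` \bigcup_i U i]].

(* Hausdorff f-measure: limit (= supremum) as delta -> 0+ *)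
Definition hausdorff_measure (f : R -> R) (A : set R) : \bar R :=
  ereal_sup [set hausdorff_content f delta A | delta in [set d : R | 0 < d]].

(* dimension function, given as a function on R whose values on (0,oo) matter *)
Definition dimension_function (f : R -> R) : Prop :=
  [/\ (forall r, 0 < r -> {for r, continuous f}),
      (forall r s, 0 < r -> r <= s -> f r <= f s),
      (forall r, 0 < r -> 0 < f r) &
      f x @[x --> 0^'+] --> 0].

Definition cantor_set (b : nat) (D : {set 'I_b}) : set R :=
  [set x | exists d : nat -> 'I_b, (forall i, d i \in D) /\
     ((fun n => \sum_(0 <= i < n) (nat_of_ord (d i))%:R / (b%:R ^+ i.+1))
        @ \oo --> x)].

Definition W_set (t : nat) (psi : nat -> R) : set R :=
  [set x | 0 <= x <= 1 /\
     infinite_set [set pn : nat * nat |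
        `|x - pn.1%:R / t%:R ^+ pn.2| < psi pn.2]].

End Defs.

(* Main.v *)
(** The proof encodes a point of [C(b,D)] by its digit sequence, and counts words.

  Convergence: if [b ^ k] is the least power at least [t ^ n], each of the [#D ^ k]
  cylinders of level [k] has diameter at most [psi n] or meets at most three of
  the intervals [B(p / t ^ n, psi n)], so the tail of the series bounds the cost
  of a cover.

  Divergence: write [t ^ q = b ^ p]. For [k] a multiple of [p], a sequence of
  digits whose entries of index [k, ..., l k - 1] all equal the special digit
  ([0] or [b - 1]) encodes a point within [b ^ - l k] of a multiple of [b ^ - k];
  take [l k] least for which this beats [psi]. Let [F m = f (b ^ - m)] and
  [g m = F m * #D ^ m]; divergence of the series gives that of the sum of
  [F (l k) * #D ^ k].
  - If [inf g = 0], then [C(b,D)] itself is null.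
  - If [g] is bounded above and away from [0], the points of [C(b,D)] for which
    the pattern occurs finitely often form a null set, by a count of words.
  - Otherwise [g] is nondecreasing and unbounded. Suppose the points with
    infinitely many patterns had a cover by cylinders of total cost less than [L].
    Spread each cost uniformly over its cylinder: the density [s] of the result is
    harmonic on the tree of words and less than [L] at the root. Whenever [s w] is
    less than the values of [g] at the levels of the covering cylinders inside [w],
    some later extension of [w] ends in a pattern and has the same property; the
    limit of these extensions is not covered. *)
Require Import Defs.
From HB Require Import structures.
From mathcomp Require Import all_boot all_order all_algebra.
From mathcomp Require Import all_classical all_reals all_analysis.
From mathcomp Require Import zify ring lra.
Import Order.TTheory GRing.Theory Num.Theory.
Import numFieldNormedType.Exports.
Local Open Scope classical_set_scope.
Local Open Scope ring_scope.
Set Implicit Arguments.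
Unset Strict Implicit.
Unset Printing Implicit Defensive.

(** * Series of real numbers with unbounded partial sums *)

Section Diverges.
Variable R : realType.
Implicit Types x y : nat -> R.

Definition diverges x := forall B, exists n, B <= \sum_(0 <= k < n) x k.

(** The terms of index below [m], where no comparison is assumed, are absorbed by raising [B] by the
    sum of their absolute values. *)
Lemma diverges_le m x y : (forall k, 0 <= y k) ->
  (forall k, (m <= k)%N -> x k <= y k) -> diverges x -> diverges y.
Proof.
move=> y0 xy dx B; have [n Bn] := dx (B + \sum_(0 <= k < m) `|x k|).
exists n; rewrite -(lerD2r (\sum_(0 <= k < m) `|x k|)) (le_trans Bn) //.
have h p : \sum_(0 <= k < p) x k <=
    \sum_(0 <= k < p) y k + \sum_(0 <= k < p | (k < m)%N) `|x k|.
  rewrite [X in _ + X]big_mkcond -big_split; apply: ler_sum => k _.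
  case: ltnP => km /=; last by rewrite addr0 xy.
  by rewrite (le_trans (ler_norm _)) // lerDr.
rewrite (le_trans (h n)) // lerD2l.
have [nm|/ltnW mn] := leqP n m.
  rewrite [leRHS](big_cat_nat (leq0n n) nm) /= big_mkcond /= ler_wpDr ?sumr_ge0 //.
  by apply: ler_sum => k _; case: ifP.
have z : \sum_(m <= k < n | (k < m)%N) `|x k| = 0.
  by rewrite big_nat_cond big_pred0 // => k; apply/negbTE; lia.
rewrite (big_cat_nat (leq0n m) mn) /= z addr0 big_mkcond.
by apply: ler_sum => k _; case: ifP.
Qed.

Lemma diverges_shift m x : (forall k, 0 <= x k) -> diverges x ->
  diverges (fun k => x (m + k)%N).
Proof.
move=> x0 dx B; have [n Bn] := dx (B + \sum_(0 <= k < m) x k); exists n.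
rewrite -(lerD2r (\sum_(0 <= k < m) x k)) (le_trans Bn) // addrC.
have -> : \sum_(0 <= k < n) x (m + k)%N = \sum_(m <= k < m + n) x k.
  by rewrite -{2}[m]add0n big_addn addKn; apply: eq_bigr => k _; rewrite addnC.
rewrite -big_cat_nat ?leq_addr //= (big_cat_nat (leq0n n) (leq_addl m n)) /=.
by rewrite lerDl sumr_ge0.
Qed.

Lemma diverges_scale c x : 0 < c -> diverges x -> diverges (fun k => c * x k).
Proof.
move=> c0 dx B; have [n Bn] := dx (c^-1 * B); exists n.
by rewrite -mulr_sumr -ler_pdivrMl.
Qed.

Lemma diverges_often c x : 0 < c -> (forall k, 0 <= x k) ->
  (forall n, exists2 k, (n <= k)%N & c <= x k) -> diverges x.
Proof.
move=> c0 x0 often B.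
have [M hM] : exists M, B <= c * M%:R.
  exists (Num.truncn (c^-1 * B)).+1; rewrite -ler_pdivrMl //.
  by rewrite ltW // truncnS_gt.
suff [n hn] : exists n, c * M%:R <= \sum_(0 <= k < n) x k.
  by exists n; rewrite (le_trans hM).
elim: M {hM} => [|M [n hn]]; first by exists 0%N; rewrite mulr0 big_geq.
have [k nk ck] := often n; exists k.+1.
rewrite big_nat_recr //= mulrSr mulrDr mulr1 lerD // (le_trans hn) //.
by rewrite (big_cat_nat (leq0n n) nk) /= lerDl sumr_ge0.
Qed.

(** Either [x] reaches [c] infinitely often, and each such index contributes [c], or the truncation
    has no effect from some index on. *)
Lemma diverges_min c x : 0 < c -> (forall k, 0 <= x k) -> diverges x ->
  diverges (fun k => Num.min c (x k)).
Proof.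
move=> c0 x0 dx.
have m0 k : 0 <= Num.min c (x k) by rewrite le_min x0 ltW.
have [often|] := pselect (forall n, exists2 k, (n <= k)%N & c <= x k).
  apply: (diverges_often c0) => // n; have [k nk ck] := often n.
  by exists k => //; rewrite min_l.
move=> /existsNP[n nP]; apply: (diverges_le (m := n)) dx => // k nk.
rewrite min_r // ltW // ltNge; apply/negP => ck.
by apply: nP; exists k.
Qed.

(** A bound for the partial sums of the last series can be subtracted, so that the sum of the others
    still diverges. This serves to select one residue class of exponents. *)
Lemma diverges_sum q (x : nat -> nat -> R) :
  (forall r k, 0 <= x r k) ->
  diverges (fun k => \sum_(0 <= r < q) x r k) -> exists2 r, (r < q)%N & diverges (x r).
Proof.
move=> x0; elim: q => [|q IH] dx.
  have [n] := dx 1; rewrite big1 ?ler10 // => k _.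
  by rewrite big_geq.
have [dq|] := pselect (diverges (x q)); first by exists q.
move=> /existsNP[B] /forallNP hB; have [|r rq dr] := IH; last by exists r => //; lia.
move=> C; have [n hn] := dx (C + B); exists n.
rewrite -(lerD2r B) (le_trans hn) //.
under eq_bigr do rewrite big_nat_recr //=.
rewrite big_split lerD2l ltW // ltNge; apply/negP; exact: hB.
Qed.

End Diverges.

(** * Averages over words *)

Section Words.
Variables (R : realType) (A : finType).
Implicit Types (u v w y z : seq A) (phi : seq A -> R).

Local Notation N := (#|A|%:R : R).

Fixpoint words (n : nat) : seq (seq A) :=
  if n is m.+1 then [seq a :: w | a <- enum A, w <- words m] else [:: [::]].

Lemma mem_words n w : (w \in words n) = (size w == n).
Proof.
elim: n w => [|n IH] [|a w] //=.
- by apply/allpairsP => -[[x y] [_ _]].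
- rewrite eqSS -IH; apply/allpairsP/idP => [[[x y] /= [_ hy [_ ->]]] //|hw].
  by exists (a, w); split => //=; rewrite mem_enum.
Qed.

Lemma size_words n : size (words n) = (#|A| ^ n)%N.
Proof. by elim: n => [//|n IH] /=; rewrite size_allpairs IH -cardE expnS. Qed.

(** The expectation of [phi] at a uniformly random word of length [n]. *)
Definition avg (n : nat) phi : R := N ^- n * \sum_(w <- words n) phi w.

Lemma avg0 phi : avg 0 phi = phi [::].
Proof. by rewrite /avg /= big_seq1 expr0 invr1 mul1r. Qed.

Lemma avgS n phi :
  avg n.+1 phi = N^-1 * \sum_a avg n (fun w => phi (a :: w)).
Proof.
rewrite /avg /= big_allpairs_dep big_enum /= exprS invfM -mulrA; congr (_ * _).
by rewrite mulr_sumr.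
Qed.

Lemma eq_avg n phi psi :
  (forall w, size w = n -> phi w = psi w) -> avg n phi = avg n psi.
Proof.
move=> h; congr (_ * _); rewrite big_seq [RHS]big_seq.
by apply: eq_bigr => w; rewrite mem_words => /eqP /h.
Qed.
Arguments eq_avg [n phi] psi.

Lemma le_avg n phi psi :
  (forall w, size w = n -> phi w <= psi w) -> avg n phi <= avg n psi.
Proof.
move=> h; rewrite ler_wpM2l ?invr_ge0 ?exprn_ge0 //.
rewrite big_seq [leRHS]big_seq; apply: ler_sum => w.
by rewrite mem_words => /eqP /h.
Qed.

Lemma avgD n phi psi : avg n (fun w => phi w + psi w) = avg n phi + avg n psi.
Proof. by rewrite /avg big_split mulrDr. Qed.

Lemma avgZ n c phi : avg n (fun w => c * phi w) = c * avg n phi.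
Proof. by rewrite /avg -mulr_sumr mulrCA. Qed.

Lemma avg_ge0 n phi : (forall w, 0 <= phi w) -> 0 <= avg n phi.
Proof. by move=> h; rewrite mulr_ge0 ?invr_ge0 ?exprn_ge0 ?sumr_ge0. Qed.

Lemma avg_cat m n phi :
  avg (m + n) phi = avg m (fun u => avg n (fun v => phi (u ++ v))).
Proof.
elim: m phi => [|m IH] phi; first by rewrite avg0.
rewrite addSn !avgS; congr (_ * _); apply: eq_bigr => a _.
by rewrite IH.
Qed.

Hypothesis A_gt0 : (0 < #|A|)%N.

Lemma N_gt0 : 0 < N. Proof. by rewrite ltr0n. Qed.

Lemma avg_cst n (c : R) : avg n (fun=> c) = c.
Proof.
elim: n => [|n IH]; first by rewrite avg0.
rewrite avgS; under eq_bigr do rewrite IH.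
by rewrite sumr_const -[c *+ _]mulr_natl mulrA mulVf ?mul1r // gt_eqF // N_gt0.
Qed.

Lemma uniq_words n : uniq (words n).
Proof.
elim: n => [//|n IH] /=; apply: allpairs_uniq => //; first exact: enum_uniq.
by move=> [a w] [a' w'] /= _ _ [-> ->].
Qed.

Lemma avg_pred1 v0 phi :
  avg (size v0) (fun v => (v == v0)%:R * phi v) = N ^- size v0 * phi v0.
Proof.
congr (_ * _); rewrite (bigD1_seq v0) ?mem_words ?uniq_words //= eqxx mul1r.
by rewrite big1 ?addr0 // => v /negPf ->; rewrite mul0r.
Qed.

(* [s] is the density, on cylinders, of a finitely additive measure with respect
   to the uniform one. *)
Definition harmonic (s : seq A -> R) :=
  forall v, s v = N^-1 * \sum_a s (rcons v a).

Lemma harmonic_avg s v n : harmonic s -> s v = avg n (fun z => s (v ++ z)).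
Proof.
move=> hs; elim: n v => [|n IH] v; first by rewrite avg0 cats0.
rewrite avgS hs; congr (_ * _); apply: eq_bigr => a _.
by rewrite IH; apply: eq_avg => w _; rewrite cat_rcons.
Qed.

(** The value at [v ++ z] is one of the nonnegative terms averaged in [harmonic_avg]. *)
Lemma harmonic_le_avg s v z : harmonic s -> (forall w, 0 <= s w) ->
  s (v ++ z) <= N ^+ size z * s v.
Proof.
move=> hs s0; rewrite (harmonic_avg v (size z) hs).
rewrite -ler_pdivrMl ?exprn_gt0 ?N_gt0 // -(avg_pred1 z (fun w => s (v ++ w))).
by apply: le_avg => w _; case: eqP => // _; rewrite ?mul1r ?mul0r.
Qed.

(* The pattern: letter [a] at position [k] followed by [c k] letters [e]. As
   [a != e], two overlapping patterns are incompatible, so that the first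
   pattern met is independent of what precedes it. *)
Section Pattern.
Variables (a e : A) (K : pred nat) (c : nat -> nat).
Hypothesis ae : a != e.

(** A word too short to hold the whole pattern does not have it, as [take] then returns fewer than
    [(c k).+1] letters. *)
Definition pat k y := take (c k).+1 (drop k y) == a :: nseq (c k) e.

Definition hit n y := has (fun k => K k && pat k y) (iota 0 n).

Lemma patE k u z : size u = k -> pat k (u ++ z) = (take (c k).+1 z == a :: nseq (c k) e).
Proof. by move=> <-; rewrite /pat drop_size_cat. Qed.

Lemma pat_cat k y z : pat k y -> pat k (y ++ z).
Proof.
rewrite /pat => /eqP h.
have hs : ((c k).+1 <= size (drop k y))%N.
  have := congr1 size h; rewrite /= size_nseq size_take.
  by case: ltnP => [/ltnW //|_ ->].
have klt : (k < size y)%N by move: hs; rewrite size_drop; lia.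
by rewrite drop_cat klt takel_cat // h.
Qed.

(** Were the pattern at [i] to reach position [k], the letter there would be [e], whereas the
    pattern at [k] starts with [a]. *)
Lemma pat_prefix i k u z : (i < k)%N -> size u = k -> pat k (u ++ z) ->
  pat i (u ++ z) = pat i u.
Proof.
move=> ik su pk; apply/idP/idP => [pi|]; last exact: pat_cat.
have [le|gt] := leqP (i + (c i).+1) k.
  move: pi; rewrite /pat drop_cat su ik takel_cat // size_drop su; lia.
case/eqP: ae; move: pi pk; rewrite /pat => /eqP pi /eqP pk.
have h1 : nth a (u ++ z) k = a.
  have := congr1 (fun s => nth a s 0) pk; rewrite /= nth_take // nth_drop.
  by rewrite addn0.
have h2 : nth a (u ++ z) k = e.
  have := congr1 (fun s => nth a s (k - i)) pi.
  rewrite nth_take ?nth_drop; last lia.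
  rewrite subnKC; last lia.
  have /prednK <- : (0 < k - i)%N by lia.
  by move=> -> /=; rewrite nth_nseq; case: ltnP => //; lia.
by rewrite -h1 h2.
Qed.

Lemma hit_cat n u z : hit n u -> hit n (u ++ z).
Proof.
by move=> /hasP[k kn /andP[Kk pk]]; apply/hasP; exists k => //; rewrite Kk pat_cat.
Qed.

Lemma hitS n y : hit n.+1 y = hit n y || (K n && pat n y).
Proof. by rewrite /hit -addn1 iotaD has_cat /= orbF. Qed.

Lemma pat_hit_prefix k u z : size u = k -> pat k (u ++ z) ->
  hit k (u ++ z) = hit k u.
Proof.
move=> su pk; apply: eq_in_has => i; rewrite mem_iota add0n => /andP[_ ik].
by rewrite (pat_prefix ik su pk).
Qed.

Definition first k y := (pat k y && ~~ hit k y)%:R : R.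

Definition alive n y := (~~ hit n y)%:R : R.

(** By [pat_hit_prefix] the event means that [u] has no pattern and is followed by one fixed block;
    the tail [z] stays free. *)
Lemma avg_first k J phi : (k + (c k).+1 <= J)%N ->
  avg J (fun y => first k y * phi y) =
  N ^- (c k).+1 * avg k (fun u => alive k u *
     avg (J - (k + (c k).+1)) (fun z => phi (u ++ a :: nseq (c k) e ++ z))).
Proof.
move=> kJ; rewrite -{1}(subnKC kJ) -addnA avg_cat -avgZ; move: (J - _)%N => r.
apply: eq_avg => u su; rewrite avg_cat.
have -> : (c k).+1 = size (a :: nseq (c k) e) by rewrite /= size_nseq.
(* Read backwards, [avg_pred1] turns the fixed block into a random block [v] with an indicator. *)
rewrite -(avg_pred1 _ (fun v => alive k u * avg _ (fun z => phi (u ++ v ++ z)))).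
apply: eq_avg => v; rewrite [size (a :: _)]/= size_nseq => sv.
rewrite -!avgZ; apply: eq_avg => z _; rewrite mulrA; congr (_ * _).
rewrite /first /alive patE // take_size_cat //.
case: eqP => [v0|_] /=; last by rewrite mul0r.
rewrite mul1r pat_hit_prefix // patE // take_size_cat //.
exact/eqP.
Qed.

Lemma alive_first n J : K n -> 
  avg J (alive n.+1) = avg J (alive n) - avg J (first n).
Proof.
move=> Kn; apply/esym/eqP; rewrite subr_eq -avgD; apply/eqP/eq_avg => w _.
by rewrite /alive /first hitS Kn /=; case: hit; case: pat; rewrite ?add0r ?addr0.
Qed.

Lemma alive_skip n J : ~~ K n -> avg J (alive n.+1) = avg J (alive n).
Proof.
by move=> Kn; apply: eq_avg => w _; rewrite /alive hitS (negPf Kn) orbF.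
Qed.

Lemma firstE k J : (k + (c k).+1 <= J)%N ->
  avg J (first k) = N ^- (c k).+1 * avg k (alive k).
Proof.
move=> kJ; rewrite (eq_avg (fun y => first k y * 1)); last by move=> *; rewrite mulr1.
rewrite avg_first //; congr (_ * _); apply: eq_avg => u _.
by rewrite avg_cst mulr1.
Qed.

Lemma alive_mono n k J : (k <= J)%N -> avg J (alive n) <= avg k (alive n).
Proof.
move=> kJ; rewrite -{1}(subnKC kJ) avg_cat; apply: le_avg => u _.
rewrite -[leRHS](avg_cst (J - k)); apply: le_avg => z _.
rewrite ler_nat /alive; case hu: (hit n u) => /=; last by case: hit.
by rewrite hit_cat.
Qed.

Definition weight k : R := if K k then N ^- (c k).+1 else 0.

(** A quantitative Borel-Cantelli lemma. For distinct [k] the events that the first pattern sits at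
    [k] are disjoint; each has probability [weight k] times that of no pattern before [k], which is
    at least that of no pattern before [n]. Their union is the complement of the event [alive n]. *)
Lemma alive_bound n J : (forall k, (k < n)%N -> K k -> (k + (c k).+1 <= J)%N) ->
  (\sum_(0 <= k < n) weight k) * avg J (alive n) <= 1 - avg J (alive n).
Proof.
elim: n => [|n IH] h.
  rewrite big_geq // mul0r subr_ge0 -[leRHS](avg_cst J).
  by apply: le_avg => w _; rewrite /alive /hit.
have {}IH := IH (fun k kn => h k (ltnW kn)).
rewrite big_nat_recr //= /weight; case: ifPn => Kn; last first.
  by rewrite addr0 alive_skip.
have nJ := h n (ltnSn n) Kn.
have fE := firstE nJ.
have aE := alive_first J Kn.
have le1 : avg J (alive n) <= avg n (alive n).
  by apply: alive_mono; lia.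
have ge0 : 0 <= avg J (first n) by apply: avg_ge0 => w; rewrite /first.
have p0 : 0 <= N ^- (c n).+1 by rewrite invr_ge0 exprn_ge0.
have s0 : 0 <= \sum_(0 <= k < n) weight k.
  by apply: sumr_ge0 => k _; rewrite /weight; case: ifP => // _; rewrite invr_ge0 exprn_ge0.
have : N ^- (c n).+1 * avg J (alive n) <= avg J (first n) by rewrite fE ler_wpM2l.
rewrite aE.
move: (avg J (alive n)) (avg J (first n)) (N ^- (c n).+1) (\sum_(0 <= k < n) weight k) IH ge0 p0 s0 => x y p S *.
nra.
Qed.

(** Given that the first pattern sits at [k], harmonicity makes the mean of [s] over the later
    letters equal to its value just after the pattern, which is at least 1. *)
Lemma harmonic_hit (s : seq A -> R) n J : harmonic s -> (forall v, 0 <= s v) ->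
  (forall k u, (k < n)%N -> K k -> size u = k -> 1 <= s (u ++ a :: nseq (c k) e)) ->
  (forall k, (k < n)%N -> K k -> (k + (c k).+1 <= J)%N) ->
  1 - avg J (alive n) <= avg J (fun y => (hit n y)%:R * s y).
Proof.
move=> hs s0; elim: n => [|n IH] hs1 hJ.
  rewrite [leRHS](eq_avg (fun=> 0)) => [|w _]; last by rewrite /hit mul0r.
  by rewrite avg_cst (eq_avg (fun=> 1)) ?avg_cst ?subrr.
have {}IH := IH (fun k u kn => hs1 k u (ltnW kn)) (fun k kn => hJ k (ltnW kn)).
have [Kn|Kn] := boolP (K n); last first.
  rewrite alive_skip // (le_trans IH) // le_eqVlt; apply/orP; left; apply/eqP.
  by apply: eq_avg => w _; rewrite hitS (negPf Kn) orbF.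
rewrite alive_first // opprB addrCA addrC.
have nJ := hJ n (ltnSn n) Kn.
apply: (@le_trans _ _ (avg J (fun y => (hit n y)%:R * s y) +
                       avg J (fun y => first n y * s y))); last first.
  rewrite -avgD; apply: le_avg => w _; rewrite hitS Kn /first /=.
  by case: hit; case: pat; rewrite ?mul0r ?mul1r ?addr0 ?add0r.
rewrite lerD // firstE // avg_first // ler_wpM2l ?invr_ge0 ?exprn_ge0 //.
apply: le_avg => u su; rewrite ler_peMr //.
rewrite (eq_avg (fun z => s ((u ++ a :: nseq (c n) e) ++ z))); last first.
  by move=> z _; rewrite -catA cat_cons.
by rewrite -harmonic_avg // hs1.
Qed.

(** Optional stopping at the first pattern: as the weights diverge, a pattern occurs with
    probability close to 1, and [s] is at least 1 there. *)
Lemma harmonic_pattern (s : seq A -> R) : harmonic s -> (forall v, 0 <= s v) ->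
  (forall k u, K k -> size u = k -> 1 <= s (u ++ a :: nseq (c k) e)) ->
  diverges weight -> 1 <= s [::].
Proof.
move=> hs s0 hs1 div; rewrite leNgt; apply/negP => s_lt1.
(* If [x] is the probability of no pattern, [harmonic_hit] gives [x >= 1 - s [::]]; with this bound
   on the weights [alive_bound] then gives [1 <= s [::]]. *)
have [n Bn] := div (1 - s [::])^-1.
pose J := (\max_(k < n) (k + (c k).+1))%N.
have hJ k : (k < n)%N -> K k -> (k + (c k).+1 <= J)%N.
  by move=> kn _; rewrite (leq_bigmax (Ordinal kn)).
have := alive_bound hJ; have := harmonic_hit hs s0 (fun k u _ => hs1 k u) hJ.
have : avg J (fun y => (hit n y)%:R * s y) <= s [::].
  rewrite (harmonic_avg [::] J hs); apply: le_avg => w _.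
  by case: hit; rewrite ?mul0r ?mul1r.
have al0 : 0 <= avg J (alive n) by apply: avg_ge0 => w; rewrite /alive.
have d0 : 0 < 1 - s [::] by lra.
move: Bn; rewrite -(@ler_pM2r _ (1 - s [::])) // mulVf ?gt_eqF //.
move: (avg J (alive n)) al0 (avg J _) (\sum_(0 <= k < n) weight k) => x x0 y S.
nra.
Qed.

End Pattern.

End Words.

(** * Mass transference on words *)

Section Density.
Variables (R : realType) (A : finType).
Local Notation N := (#|A|%:R : R).

(* The density at [v] of the uniform probability on the cylinder [u]. *)
Fixpoint dens (u v : seq A) : R :=
  match u, v with
  | x :: u', y :: v' => if x == y then N * dens u' v' else 0
  | _, _ => 1
  end.

Lemma dens_ge0 u v : 0 <= dens u v.
Proof.
by elim: u v => [|x u IH] [|y v] //=; case: eqP => // _; rewrite mulr_ge0.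
Qed.

Lemma dens_catr u z : dens u (u ++ z) = N ^+ size u.
Proof. by elim: u z => [|x u IH] z /=; rewrite ?expr0 // eqxx IH exprS. Qed.

Lemma dens_catl v z : dens (v ++ z) v = N ^+ size v.
Proof.
by elim: v z => [|x v IH] z /=; [case: z|rewrite eqxx IH exprS].
Qed.

Lemma dens_nil u : dens u [::] = 1.
Proof. by case: u. Qed.

Lemma harmonic_dens u : (0 < #|A|)%N -> harmonic (dens u).
Proof.
move=> A0 v; have N0 : N != 0 by rewrite gt_eqF // ltr0n.
elim: v u => [|y v IH] [|x u] /=.
- by rewrite sumr_const -[1 *+ _]mulr_natl mulr1 mulVf.
- rewrite (bigD1 x) //= eqxx dens_nil mulr1 big1 ?addr0 ?mulVf // => i /negPf.
  by rewrite eq_sym => ->.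
- by rewrite sumr_const -[1 *+ _]mulr_natl mulr1 mulVf.
- case: eqP => _; last by rewrite big1 ?mulr0.
  by rewrite -mulr_sumr mulrCA -IH.
Qed.

End Density.

Section MassTransference.
Variables (R : realType) (A : finType) (a e : A) (F : nat -> R).
Variables (V : nat -> seq (seq A)) (K : pred nat) (l : nat -> nat).
Local Notation N := (#|A|%:R : R).
Local Notation g m := (F m * N ^+ m).

Hypotheses (ae : a != e) (F_gt0 : forall m, 0 < F m).
Hypotheses (F_dec : forall m n, (m <= n)%N -> F n <= F m).
Hypotheses (g_inc : forall m n, (m <= n)%N -> g m <= g n).
Hypotheses (g_unbounded : forall B, exists m, B <= g m).
Hypotheses (l_ge : forall k, K k -> (k <= l k)%N).
Hypotheses (lK : diverges (fun k => if K k then F (l k) * N ^+ k else 0)).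

Let A_gt0 : (0 < #|A|)%N. Proof. by apply/card_gt0P; exists a. Qed.
Let N0 : 0 < N. Proof. by rewrite ltr0n. Qed.

Definition charge_at i v := \sum_(u <- V i) F (size u) * dens R u v.

Lemma charge_at_ge0 i v : 0 <= charge_at i v.
Proof. by apply: sumr_ge0 => u _; rewrite mulr_ge0 ?dens_ge0 // ltW. Qed.

Lemma harmonic_charge_at i : harmonic (charge_at i).
Proof.
move=> v; rewrite exchange_big mulr_sumr; apply: eq_bigr => u _ /=.
by rewrite -mulr_sumr mulrCA -harmonic_dens.
Qed.

Definition charge v : R := fine (\sum_(i <oo) (charge_at i v)%:E)%E.

Variable L0 : R.
Hypothesis cost_lt : (\sum_(i <oo) (\sum_(u <- V i) F (size u))%:E < L0%:E)%E.

(** Finiteness holds because each [charge_at i] grows by a factor at most [N ^+ size v] from the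
    root to [v], and at the root these sum to the total cost. *)
Lemma chargeE v : ((charge v)%:E = \sum_(i <oo) (charge_at i v)%:E)%E.
Proof.
have q0 i w : (0 <= (charge_at i w)%:E)%E by rewrite lee_fin charge_at_ge0.
rewrite /charge fineK // ge0_fin_numE ?nneseries_ge0 //.
apply: (@le_lt_trans _ _ ((N ^+ size v)%:E *
    \sum_(i <oo) (\sum_(u <- V i) F (size u))%:E)%E).
  rewrite -nneseriesZl; last by move=> i _; rewrite lee_fin sumr_ge0 // => u _; exact: ltW.
  apply: lee_nneseries => // i _; rewrite -EFinM lee_fin.
  apply: (le_trans (harmonic_le_avg A_gt0 [::] v (harmonic_charge_at i) (charge_at_ge0 i))).
  rewrite ler_wpM2l ?exprn_ge0 //; apply: ler_sum => u _.
  by rewrite dens_nil mulr1.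
by rewrite lte_mul_pinfty ?lee_fin ?exprn_ge0 // (lt_trans cost_lt) ?ltry.
Qed.

Lemma charge_ge0 v : 0 <= charge v.
Proof.
by rewrite -lee_fin chargeE nneseries_ge0 // => i _ _; rewrite lee_fin charge_at_ge0.
Qed.

Lemma harmonic_charge : harmonic charge.
Proof.
move=> v; apply: EFin_inj; rewrite EFinM -sumEFin chargeE.
under eq_bigr do rewrite chargeE.
rewrite -nneseries_sum; last by move=> b i _; rewrite lee_fin charge_at_ge0.
rewrite -nneseriesZl; last first.
  by move=> i _; apply: sume_ge0 => b _; rewrite lee_fin charge_at_ge0.
by apply: eq_eseriesr => i _; rewrite sumEFin -EFinM -harmonic_charge_at.
Qed.

Lemma charge_ge i u v : u \in V i -> F (size u) * dens R u v <= charge v.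
Proof.
move=> uV; rewrite -lee_fin chargeE.
apply: (@le_trans _ _ (charge_at i v)%:E).
  rewrite lee_fin /charge_at (big_rem u) //= lerDl sumr_ge0 // => w _.
  by rewrite mulr_ge0 ?dens_ge0 // ltW.
rewrite (nneseriesD1 (n := i)) //; last by move=> k _; rewrite lee_fin charge_at_ge0.
by rewrite leeDl // nneseries_ge0 // => k _ _; rewrite lee_fin charge_at_ge0.
Qed.

(* By the last clause, a cylinder of the cover containing [w] would contribute at
   least [L] to [charge w]; so [w] is not covered. *)
Definition good w L := [/\ 0 < L, charge w < L &
  forall i u, u \in V i -> prefix u w || prefix w u -> L <= g (size u)].

Lemma prefix_total (u v w : seq A) : prefix u w -> prefix v w ->
  (size u <= size v)%N -> prefix u v.
Proof.
rewrite !prefixE => /eqP hu /eqP hv uv; apply/eqP.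
by rewrite -hv take_takel // hu.
Qed.

(** If no such extension existed, the charge would be at least [L] after every pattern with a run of
    suitable length [c k]; then [harmonic_pattern], applied to the charge below [w] divided by [L],
    would give [charge w >= L]. *)
Lemma good_step w L n : good w L -> exists k z, [/\ K k, (n <= k)%N, (size w < k)%N &
  [/\ size (w ++ z) = l k, (forall i, (k <= i)%N -> nth e (w ++ z) i = e) &
   good (w ++ z) (g (l k))]].
Proof.
move=> [L_gt0 wL gL]; apply: contrapT => nex.
have [n1 n1L] := g_unbounded L.
(* A pattern at position [k] after [w] begins with the letter [a], so its run of [e] starts at
   position [t k] of the whole word. *)
pose t k := ((size w).+1 + k)%N.
pose K' k := K (t k) && (maxn n n1 <= t k)%N.
(* The target cylinder, of level [l (t k)], is enlarged to the level [t k + c k]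
   at which a density [L] costs at most [F (l (t k))]. *)
have /choice[c hc] : forall k, exists c, K' k -> [/\ (t k + c <= l (t k))%N,
    L <= F (l (t k)) * N ^+ (t k + c) &
    Num.min 1 (L^-1 * N^-1 * (F (l (t k)) * N ^+ t k)) <= N ^- c].
  move=> k; have [/andP[Kt]|_] := boolP (K' k); last by exists 0%N.
  rewrite geq_max => /andP[_ n1t].
  have tl := l_ge Kt.
  have exc : exists c, L <= F (l (t k)) * N ^+ (t k + c).
    by exists (l (t k) - t k)%N; rewrite subnKC // (le_trans n1L) // g_inc; lia.
  case: (ex_minnP exc) => c Lc cmin; exists c => _; split => //.
    suff : (c <= l (t k) - t k)%N by lia.
    by apply: cmin; rewrite subnKC // (le_trans n1L) // g_inc; lia.
  case: c Lc cmin => [|c] Lc cmin; first by rewrite expr0 invr1 ge_min lexx.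
  rewrite ge_min; apply/orP; right.
  have {cmin} : F (l (t k)) * N ^+ (t k + c) < L.
    by rewrite ltNge; apply/negP => /cmin; lia.
  move=> /ltW h; rewrite exprS invfM [L^-1 * _]mulrC -mulrA ler_wpM2l ?invr_ge0 //.
  by rewrite ler_pdivrMl // ler_pdivlMr ?exprn_gt0 // -mulrA -exprD.
suff : 1 <= charge (w ++ [::]) / L by rewrite cats0 ler_pdivlMr // mul1r leNgt wL.
apply: (@harmonic_pattern _ _ A_gt0 a e K' c ae (fun v => charge (w ++ v) / L)).
- move=> v; rewrite -mulr_suml mulrA; congr (_ * _).
  by rewrite harmonic_charge; congr (_ * _); apply: eq_bigr => b _; rewrite rcons_cat.
- by move=> v; rewrite divr_ge0 ?charge_ge0 // ltW.
- move=> k u K'k su; rewrite ler_pdivlMr // mul1r.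
  have [cl Lc _] := hc k K'k; move: K'k => /andP[Kt].
  rewrite geq_max => /andP[nt _].
  set v := w ++ _.
  have sv : size v = (t k + c k)%N by rewrite /v size_cat size_cat /= size_nseq su /t; lia.
  pose y := nseq (l (t k) - (t k + c k)) e.
  have svy : size (v ++ y) = l (t k) by rewrite size_cat sv size_nseq subnKC.
  (* If the charge at [v] is below [L], completing the run by [y] multiplies it by at most
     [N ^+ size y], which keeps it below [g (l (t k))] by the choice of [c k]; the completed word is
     then good, against [nex]. *)
  have [//|vL] := leP L (charge v).
  case: nex; exists (t k), (u ++ a :: nseq (c k) e ++ y).
  have vE : w ++ (u ++ a :: nseq (c k) e ++ y) = v ++ y.
    by rewrite /v -!catA /= -?catA.
  rewrite vE svy; split => //.
    by rewrite /t; lia.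
  split => //.
    move=> i ti; rewrite /y /v catA -cat_rcons -!catA nth_cat size_rcons size_cat su.
    case: ltnP => [|_]; first by rewrite /t in ti; lia.
    by rewrite nth_cat; case: ltnP => _; rewrite nth_nseq if_same.
  split; first by rewrite mulr_gt0 ?exprn_gt0.
    apply: (le_lt_trans (harmonic_le_avg A_gt0 v y harmonic_charge charge_ge0)).
    rewrite size_nseq -ltr_pdivlMl ?exprn_gt0 // (lt_le_trans vL) // (le_trans Lc) //.
    rewrite ler_pdivlMl ?exprn_gt0 // mulrCA ler_wpM2l //.
      exact: ltW.
    by rewrite -exprD subnK.
  (* A covering cylinder [x] around the new word of level below [l (t k)] would contribute at least
     [L] to the charge at [v]: by [L <= g (size x)] if it contains the cylinder of [v], by the
     choice of [c k] if it lies inside. *)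
  move=> i x xV /orP[xp|/size_prefix]; last by rewrite svy => ?; apply: g_inc.
  have [?|xl] := leqP (l (t k)) (size x); first exact: g_inc.
  have gx : L <= g (size x).
    apply: gL xV _; have wp : prefix w (v ++ y) by rewrite /v -catA prefix_prefix.
    by have [/(prefix_total xp wp) ->//|/ltnW /(prefix_total wp xp) ->] := leqP (size x) (size w);
      rewrite orbT.
  have vp : prefix v (v ++ y) by rewrite prefix_prefix.
  have := charge_ge v xV; move: vL => /[swap].
  have [/(prefix_total xp vp)|/ltnW /(prefix_total vp xp)] := leqP (size x) (size v).
    by move=> /prefixP[z' ->]; rewrite dens_catr; lra.
  move=> /prefixP[z' xE]; rewrite {2}xE dens_catl sv.
  have : F (l (t k)) * N ^+ (t k + c k) <= F (size x) * N ^+ (t k + c k).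
    by rewrite ler_wpM2r ?exprn_ge0 // F_dec // ltnW.
  lra.
(* The third property in [hc] bounds the weights below; the additional factor [N^-1] accounts for
   the letter [a]. *)
- have x0 k : 0 <= (if K k then F (l k) * N ^+ k else 0).
    by case: ifP => // _; rewrite mulr_ge0 ?exprn_ge0 // ltW.
  have N1 : 0 < L^-1 * N^-1 by rewrite mulr_gt0 ?invr_gt0.
  have := diverges_scale N1 (diverges_shift (size w).+1 x0 lK).
  move=> /(diverges_min ltr01) dm.
  have {dm} := dm (fun k => mulr_ge0 (ltW N1) (x0 ((size w).+1 + k)%N)).
  move=> /(diverges_scale (c := N^-1)); rewrite invr_gt0 => /(_ N0).
  apply: (diverges_le (m := maxn n n1)) => k.
    by rewrite /weight; case: ifP => // _; rewrite invr_ge0 exprn_ge0.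
  move=> nk; have mk : (maxn n n1 <= t k)%N by rewrite (leq_trans nk) // leq_addl.
  rewrite /weight /K' mk andbT -/(t k); case: ifP => Kt.
    have [|_ _ h] := hc k; first by rewrite /K' Kt.
    by rewrite exprS invfM ler_wpM2l // invr_ge0.
  by rewrite mulr0 (min_r ler01) mulr0.
Qed.

(** Iterating [good_step] gives nested good words with limit [d]. A covering cylinder containing [d]
    would be given by a prefix of one of these words, and [charge_ge] would contradict its
    goodness. *)
Theorem symbolic_mass_transference : 0 < L0 ->
  (forall i u, u \in V i -> L0 <= g (size u)) ->
  exists d : nat -> A, (forall i u, u \in V i -> mkseq d (size u) <> u) /\
    forall n, exists k, [/\ (n <= k)%N, K k & forall i, (k <= i < l k)%N -> d i = e].
Proof.
move=> L_gt0 gL.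
have charge0 : charge [::] < L0.
  rewrite -lte_fin chargeE (le_lt_trans _ cost_lt) //; apply: lee_nneseries => i _.
    by move=> _; rewrite lee_fin charge_at_ge0.
  by rewrite lee_fin; apply: ler_sum => u _; rewrite dens_nil mulr1.
pose state := {w | exists L, good w L}.
have st0 : exists L, good [::] L by exists L0; split => // i u uV _; apply: gL uV.
have : forall st : nat * state, exists st' : state, exists k z,
    [/\ K k, (st.1 <= k)%N, (size (sval st.2) < k)%N &
    [/\ sval st' = sval st.2 ++ z, size (sval st') = l k &
     forall i, (k <= i)%N -> nth e (sval st') i = e]].
  move=> [n [w [M gw]]] /=.
  have [k [z [Kk nk wk [sz ez gz]]]] := good_step n gw.
  by exists (exist _ (w ++ z) (ex_intro _ _ gz)), k, z.
move=> /choice[nxt hnxt].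
(* The counter [m] handed to [nxt] forces the runs to start arbitrarily far. *)
pose fix st n : state := if n is m.+1 then nxt (m, st m) else exist _ [::] st0.
have stS n : exists z, sval (st n.+1) = sval (st n) ++ z.
  by have [k [z [_ _ _ [? _ _]]]] := hnxt (n, st n); exists z.
have stsz n : (n <= size (sval (st n)))%N.
  elim: n => // n IH; have [k [z [Kk _ wk [_ -> _]]]] := hnxt (n, st n).
  exact: leq_trans (leq_ltn_trans IH wk) (l_ge Kk).
have stp m n : (m <= n)%N -> prefix (sval (st m)) (sval (st n)).
  move=> /subnKC <-; elim: (n - m)%N => [|p IH]; first by rewrite addn0 prefix_refl.
  by rewrite addnS; have [z ->] := stS (m + p)%N; rewrite prefix_catl.
pose d i := nth e (sval (st i.+1)) i.
have dE n i : (i < size (sval (st n)))%N -> nth e (sval (st n)) i = d i.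
  move=> ilt; have [/stp|/ltnW /stp] := leqP n i.+1.
    by move=> /prefixP[z zE]; rewrite /d zE nth_cat ilt.
  by move=> /prefixP[z ->]; rewrite nth_cat stsz.
exists d; split.
  move=> i u uV du; pose n := size u.
  have un : prefix u (sval (st n)).
    rewrite prefixE; apply/eqP; rewrite -[RHS]du.
    apply: (@eq_from_nth _ e) => [|j]; rewrite size_takel ?stsz // ?size_mkseq //.
    move=> ju; rewrite nth_take // nth_mkseq // dE //.
    exact: leq_trans ju (stsz n).
  case: (svalP (st n)) => M [_ cM /(_ i u uV)]; rewrite un => /(_ isT).
  have := charge_ge (sval (st n)) uV; move/prefixP: un cM => [z ->].
  rewrite dens_catr => *; lra.
move=> n; have [k [z [Kk nk _ [_ sz ez]]]] := hnxt (n, st n).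
exists k; split => // i /andP[ki ilk].
by rewrite -(dE n.+1) /= ?sz // ez.
Qed.

End MassTransference.

(** * Hausdorff contents *)

Section HausdorffContent.
Variables (R : realType) (f : R -> R).
Hypotheses (f_gt0 : forall r, 0 < r -> 0 < f r).
Hypotheses (f_mono : forall r s, 0 < r -> r <= s -> f r <= f s).
Implicit Types (A B U : set R) (delta rho : R).

Lemma diam_le U rho : (forall x y, U x -> U y -> `|x - y| <= rho) ->
  (diam U <= rho%:E)%E.
Proof.
by move=> h; apply: ge_ereal_sup => _ [x Ux [y Uy <-]]; rewrite lee_fin h.
Qed.

Lemma le_diam U rho : (diam U <= rho%:E)%E ->
  forall x y, U x -> U y -> `|x - y| <= rho.
Proof.
move=> h x y Ux Uy; rewrite -lee_fin (le_trans _ h) //.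
by apply: ereal_sup_ubound; exists x => //; exists y.
Qed.

(** The bound on the diameter excludes [+oo], which [fine] sends to 0, where [f] is arbitrary. *)
Lemma cover_cost_ge0 U delta : (diam U <= delta%:E)%E -> 0 <= cover_cost f U.
Proof.
rewrite /cover_cost; case: ifP => //; case: (diam U) => [r||] //=.
by rewrite lte_fin => r0 _; exact/ltW/f_gt0.
Qed.

Lemma cover_cost_le U rho : 0 < rho -> (diam U <= rho%:E)%E ->
  cover_cost f U <= f rho.
Proof.
rewrite /cover_cost => rho0; case: ifP => [|_ _]; last exact/ltW/f_gt0.
by case: (diam U) => [r||] //=; rewrite lte_fin lee_fin => *; apply: f_mono.
Qed.

Lemma hausdorff_content_ge0 delta A : (0 <= hausdorff_content f delta A)%E.
Proof.
apply: le_ereal_inf_tmp => _ [U [dU _] <-].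
by apply: nneseries_ge0 => i _ _; rewrite lee_fin (cover_cost_ge0 (dU i)).
Qed.

Lemma hausdorff_content_mono delta A B : A `<=` B ->
  (hausdorff_content f delta A <= hausdorff_content f delta B)%E.
Proof.
move=> AB; apply: ereal_inf_le_tmp => _ [U [dU BU] <-].
by exists U => //; split => //; exact: subset_trans BU.
Qed.

(** Covers optimal up to [e / 2 ^ n.+1] are merged along a bijection of [nat] with [nat * nat]. *)
Lemma hausdorff_content_bigcup delta (A : (set R)^nat) (x : R^nat) :
  (forall n, hausdorff_content f delta (A n) <= (x n)%:E)%E ->
  (hausdorff_content f delta (\bigcup_n A n) <= \sum_(n <oo) (x n)%:E)%E.
Proof.
move=> Ax; apply/lee_addgt0Pr => e e0.
have x0 n : (0 <= (x n)%:E)%E by exact: le_trans (hausdorff_content_ge0 _ _) (Ax n).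
apply: le_trans (epsilon_trick _ x0 (ltW e0)).
have /choice[G hG] : forall n, exists G : nat -> set R,
    [/\ forall k, (diam (G k) <= delta%:E)%E, A n `<=` \bigcup_k G k &
      (\sum_(k <oo) (cover_cost f (G k))%:E <= (x n)%:E + (e / (2 ^ n.+1)%:R)%:E)%E].
  move=> n; have en : 0 < e / (2 ^ n.+1)%:R by rewrite divr_gt0 // ltr0n expn_gt0.
  have /ereal_inf_lt[_ [G [dG AG] <-] lt] :
      (hausdorff_content f delta (A n) < (x n)%:E + (e / (2 ^ n.+1)%:R)%:E)%E.
    by rewrite (le_lt_trans (Ax n)) // -EFinD lte_fin ltrDl.
  by exists G; split => //; exact: ltW.
have cG n k : (0 <= (cover_cost f (G n k))%:E)%E.
  by have [dG _ _] := hG n; rewrite lee_fin (cover_cost_ge0 (dG k)).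
have /card_esym/ppcard_eqP[h] := card_nat2.
apply: (@le_trans _ _ (\sum_(i <oo) (cover_cost f (G (h i).1 (h i).2))%:E)%E).
  apply: ereal_inf_lbound; exists (fun i => G (h i).1 (h i).2) => //; split.
    by move=> i; have [dG _ _] := hG (h i).1.
  move=> t [n _ At]; have [_ AG _] := hG n; have [k _ Gt] := AG t At.
  by exists (h^-1%FUN (n, k)) => //; rewrite invK ?inE.
rewrite nneseries_esumT // -(reindex_esum setT setT h
  (fun nk => (cover_cost f (G nk.1 nk.2))%:E)); last exact: bij.
have -> : [set: nat * nat] = [set: nat] `*`` (fun=> [set: nat]).
  by rewrite predeqE.
rewrite -(esum_esum (a := fun n k => (cover_cost f (G n k))%:E)) //.
rewrite -nneseries_esumT; last by move=> n; apply: esum_ge0.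
apply: lee_nneseries => n _; first by move=> _; apply: esum_ge0.
by rewrite -nneseries_esumT //; have [_ _] := hG n.
Qed.

Lemma hausdorff_content_seq (T : eqType) (s : seq T) (U : T -> set R) delta rho A :
  0 < rho -> rho <= delta -> (forall t, t \in s -> (diam (U t) <= rho%:E)%E) ->
  (forall x, A x -> exists2 t, t \in s & U t x) ->
  (hausdorff_content f delta A <= ((size s)%:R * f rho)%:E)%E.
Proof.
move=> rho0 rd dU AU.
have fr0 := ltW (f_gt0 rho0).
(* The finite family is padded with empty sets, which cost 0. *)
pose W i := nth set0 (map U s) i.
have W0 i : (size s <= i)%N -> W i = set0 by move=> ?; rewrite /W nth_default ?size_map.
have dW i : (diam (W i) <= rho%:E)%E.
  have [is_|/W0 ->] := ltnP i (size s); last by apply: diam_le.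
  have [t0] : inhabited T by case: (s) is_ => // t0.
  by rewrite /W (nth_map t0) // dU // mem_nth.
apply: (@le_trans _ _ (\sum_(i <oo) (cover_cost f (W i))%:E)%E).
  apply: ereal_inf_lbound; exists W => //; split.
    by move=> i; rewrite (le_trans (dW i)) // lee_fin.
  move=> x /AU[t ts Ut]; exists (index t s) => //.
  by rewrite /W (nth_map t) ?index_mem // nth_index.
apply: lime_le.
  by apply: is_cvg_nneseries => i _ _; rewrite lee_fin (cover_cost_ge0 (dW i)).
apply: nearW => n; rewrite sumEFin lee_fin.
have -> : (size s)%:R * f rho = \sum_(0 <= i < size s) f rho.
  by rewrite sumr_const_nat subn0 mulr_natl.
have c0 i : (size s <= i)%N -> cover_cost f (W i) = 0.
  move=> /W0 ->; rewrite /cover_cost.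
  suff -> : diam (set0 : set R) = -oo%E by [].
  by apply/eqP; rewrite -leeNy_eq; apply: ge_ereal_sup => y [x x0]; case: x0.
apply: (@le_trans _ _ (\sum_(0 <= i < maxn n (size s)) cover_cost f (W i))).
  rewrite [leRHS](big_cat_nat (leq0n n) (leq_maxl _ _)) /= lerDl sumr_ge0 // => i _.
  exact: cover_cost_ge0 (dW i).
rewrite (big_cat_nat (leq0n (size s)) (leq_maxr _ _)) /= [X in _ + X]big_nat_cond.
rewrite [X in _ + X]big1 ?addr0; last by move=> i /andP[/andP[si _] _]; exact: c0.
by apply: ler_sum => i _; exact: cover_cost_le (dW i).
Qed.

Lemma hausdorff_measure_mono A B : A `<=` B ->
  (hausdorff_measure f A <= hausdorff_measure f B)%E.
Proof.
move=> AB; apply: ge_ereal_sup => _ [delta d0 <-].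
by rewrite (le_trans (hausdorff_content_mono delta AB)) // ereal_sup_ubound //; exists delta.
Qed.

Lemma hausdorff_content_le_measure delta A : 0 < delta ->
  (hausdorff_content f delta A <= hausdorff_measure f A)%E.
Proof. by move=> d0; apply: ereal_sup_ubound; exists delta. Qed.

Lemma hausdorff_measure_eq0 A :
  (forall delta e, 0 < delta -> 0 < e -> (hausdorff_content f delta A <= e%:E)%E) ->
  hausdorff_measure f A = 0%E.
Proof.
move=> h; apply/eqP; rewrite eq_le; apply/andP; split.
  apply: ge_ereal_sup => _ [delta d0 <-]; apply/lee_addgt0Pr => e e0.
  by rewrite add0e h.
by rewrite (le_trans (hausdorff_content_ge0 1 A)) // hausdorff_content_le_measure.
Qed.

Lemma hausdorff_measure_bigcup0 (A : (set R)^nat) :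
  (forall n, hausdorff_measure f (A n) = 0%E) ->
  hausdorff_measure f (\bigcup_n A n) = 0%E.
Proof.
move=> h; apply: hausdorff_measure_eq0 => delta e d0 e0.
rewrite (le_trans (hausdorff_content_bigcup (x := fun=> 0) _)) //.
  by move=> n; rewrite (le_trans (hausdorff_content_le_measure _ d0)) // h.
by rewrite eseries0 //= lee_fin ltW.
Qed.

Lemma hausdorff_measure_setU0 A B : hausdorff_measure f B = 0%E ->
  (hausdorff_measure f (A `|` B) <= hausdorff_measure f A)%E.
Proof.
move=> B0; apply: ge_ereal_sup => _ [delta d0 <-].
have := hausdorff_content_le_measure A d0.
case E : (hausdorff_content f delta A) => [r||] le; last 2 first.
- by rewrite (le_trans _ le) // leey.
- by have := hausdorff_content_ge0 delta A; rewrite E.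
apply: le_trans le.
pose C n := if n is 0%N then A else B.
pose x n := if n is 0%N then r else 0.
have : (hausdorff_content f delta (\bigcup_n C n) <= \sum_(n <oo) (x n)%:E)%E.
  apply: hausdorff_content_bigcup => -[|n] /=; first by rewrite E.
  by rewrite (le_trans (hausdorff_content_le_measure _ d0)) // B0.
rewrite nneseries_recl //; last first.
  by case=> // _; rewrite lee_fin -lee_fin -E hausdorff_content_ge0.
rewrite [X in (_ + X)%E]eseries0 ?adde0; last by case.
apply: le_trans; apply: hausdorff_content_mono => t [At|Bt].
  by exists 0%N.
by exists 1%N.
Qed.

End HausdorffContent.

(** * Digit expansions *)

Section Coding.
Variables (R : realType) (b : nat) (D : {set 'I_b}).
Hypothesis b_gt1 : (1 < b)%N.

Definition digit := {i : 'I_b | i \in D}.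
Implicit Types (u v w : seq digit) (d : nat -> digit) (x y : R).

Local Notation B := (b%:R : R).

Lemma card_digit : #|{: digit}| = #|D|.
Proof. by rewrite card_sig; apply: eq_card => i. Qed.

Lemma b_gt0 : 0 < B. Proof. by rewrite ltr0n; lia. Qed.

Lemma bX_gt0 n : 0 < B ^+ n. Proof. exact/exprn_gt0/b_gt0. Qed.

Definition num w : nat := foldl (fun s (i : digit) => s * b + sval i)%N 0%N w.

Lemma num_rcons w i : num (rcons w i) = (num w * b + sval i)%N.
Proof. by rewrite /num foldl_rcons. Qed.

Lemma num_cat u v : num (u ++ v) = (num u * b ^ size v + num v)%N.
Proof.
elim/last_ind: v => [|v i IH]; first by rewrite cats0 muln1 addn0.
rewrite -rcons_cat !num_rcons IH size_rcons expnS; nia.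
Qed.

Lemma num_lt w : (num w < b ^ size w)%N.
Proof.
elim/last_ind: w => [//|w i IH]; rewrite num_rcons size_rcons expnS.
have := ltn_ord (sval i); nia.
Qed.

Lemma num_inj u v : size u = size v -> num u = num v -> u = v.
Proof.
elim/last_ind: u v => [|u i IH] v; first by case: v.
case/lastP: v => [|v j]; first by rewrite size_rcons.
rewrite !size_rcons !num_rcons => -[suv] h.
have hi := ltn_ord (sval i); have hj := ltn_ord (sval j).
have /val_inj/val_inj -> : (sval i : nat) = sval j.
  by have := congr1 (modn^~ b) h; rewrite !modnMDl !modn_small.
rewrite (IH v) //; have b0 : (0 < b)%N by lia.
by have := congr1 (divn^~ b) h; rewrite /= !divnMDl // !divn_small // !addn0.
Qed.

Lemma mkseqD (T : Type) (s : nat -> T) m n :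
  mkseq s (m + n) = mkseq s m ++ mkseq (fun i => s (m + i)%N) n.
Proof. by rewrite /mkseq iotaD map_cat; have := iotaDl m 0 n; rewrite addn0 => ->; rewrite -map_comp. Qed.

(** Membership in all the nested closed [b]-adic intervals of [d], multiplied out by [B ^+ n]. As
    the intervals are closed, a point may have two codes. *)
Definition codes d x := forall n,
  (num (mkseq d n))%:R <= x * B ^+ n <= (num (mkseq d n)).+1%:R.

Lemma num_mkseq d m n : (num (mkseq d m) * b ^ n <= num (mkseq d (m + n)))%N /\
  (num (mkseq d (m + n)) < (num (mkseq d m)).+1 * b ^ n)%N.
Proof.
rewrite mkseqD num_cat size_mkseq; have := num_lt (mkseq (fun i => d (m + i)%N) n).
rewrite size_mkseq; nia.
Qed.

Lemma partial_sum d n :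
  \sum_(0 <= i < n) (sval (d i) : nat)%:R / B ^+ i.+1 = (num (mkseq d n))%:R / B ^+ n.
Proof.
elim: n => [|n IH]; first by rewrite big_geq // mul0r.
rewrite big_nat_recr //= IH mkseqS num_rcons natrD natrM exprS.
by field; rewrite gt_eqF ?bX_gt0 // gt_eqF ?b_gt0.
Qed.

Lemma cvg_codes d x :
  (fun n => (num (mkseq d n))%:R / B ^+ n) @ \oo --> x -> codes d x.
Proof.
set s := (fun n => _) => sx n.
have cs : cvgn s by apply/cvg_ex; exists x.
have xE := cvg_lim (@Rhausdorff R) sx.
suff : (num (mkseq d n))%:R / B ^+ n <= x <= (num (mkseq d n)).+1%:R / B ^+ n.
  by rewrite ler_pdivrMr ?ler_pdivlMr ?bX_gt0.
rewrite -xE.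
have h m : (num (mkseq d n))%:R / B ^+ n <= s (n + m)%N <= (num (mkseq d n)).+1%:R / B ^+ n.
  have [lo hi] := num_mkseq d n m.
  rewrite /s exprD invfM mulrA [_ * B ^- n * _]mulrAC !ler_pM2r ?invr_gt0 ?bX_gt0 //.
  rewrite ler_pdivlMr ?bX_gt0 // ler_pdivrMr ?bX_gt0 // -natrX -!natrM !ler_nat.
  by rewrite lo ltnW.
apply/andP; split.
  apply: limr_ge => //; exists n => // m /= nm.
  by have := h (m - n)%N; rewrite subnKC // => /andP[].
apply: limr_le => //; exists n => // m /= nm.
by have := h (m - n)%N; rewrite subnKC // => /andP[].
Qed.

Lemma cvg_bXV : (fun n => B ^- n) @ \oo --> (0 : R).
Proof.
have := @cvg_expr R B^-1; rewrite ger0_norm ?invr_ge0 // => /(_ _).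
have -> : (fun n => B ^- n) = (fun n => B^-1 ^+ n) by apply/funext => n; rewrite exprVn.
by apply; rewrite invf_lt1 ?b_gt0 // ltr1n.
Qed.

Lemma codes_cvg d x : codes d x ->
  (fun n => (num (mkseq d n))%:R / B ^+ n) @ \oo --> x.
Proof.
move=> dx; apply: (@squeeze_cvgr _ _ _ _ (fun n => x - B ^- n) (fun=> x)); last 2 first.
- by rewrite -[X in _ --> X]subr0; apply: cvgB; [exact: cvg_cst|exact: cvg_bXV].
- exact: cvg_cst.
apply: nearW => n; have /andP[lo hi] := dx n.
rewrite lerBlDr -[X in _ + X]mul1r -mulrDl natr1.
by rewrite ler_pdivlMr ?bX_gt0 // hi ler_pdivrMr ?bX_gt0.
Qed.

Lemma cantorP x : cantor_set D x <-> exists d, codes d x.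
Proof.
split=> [[d [dD dx]]|[d dx]].
  exists (fun i => exist _ (d i) (dD i)); apply: cvg_codes.
  apply: cvg_trans dx; apply: near_eq_cvg; apply: nearW => n.
  by rewrite -partial_sum.
exists (fun i => sval (d i)); split=> [i|]; first exact: svalP (d i).
apply: cvg_trans (codes_cvg dx); apply: near_eq_cvg; apply: nearW => n.
by rewrite -partial_sum.
Qed.

Lemma codes_exists d : exists x, codes d x.
Proof.
pose s n := (num (mkseq d n))%:R / B ^+ n.
have cs : cvgn s.
  apply: nondecreasing_is_cvgn.
    apply/nondecreasing_seqP => n; have [lo _] := num_mkseq d n 1.
    rewrite /s -addn1 exprD expr1 ler_pdivrMr ?bX_gt0 // mulrAC ler_pdivlMr ?mulr_gt0 ?bX_gt0 ?b_gt0 //.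
    rewrite mulrCA mulrC ler_pM2r ?bX_gt0 // mulrC -natrM ler_nat.
    by move: lo; rewrite expn1 mulnC.
  exists 1 => _ [n _ <-]; rewrite /s ler_pdivrMr ?bX_gt0 // mul1r -natrX ler_nat.
  by have := num_lt (mkseq d n); rewrite size_mkseq => /ltnW.
by exists (limn s); apply: cvg_codes.
Qed.

Lemma codes01 d x : codes d x -> 0 <= x <= 1.
Proof. by move=> /(_ 0%N); rewrite expr0 mulr1. Qed.

Lemma codes_close d d' x y n : codes d x -> codes d' y ->
  mkseq d n = mkseq d' n -> `|x - y| <= B ^- n.
Proof.
move=> /(_ n) dx /(_ n) + dd; rewrite -dd => dy.
rewrite -[leRHS]mul1r ler_pdivlMr ?bX_gt0 //.
rewrite -[X in `|_| * X](gtr0_norm (bX_gt0 n)) -normrM mulrBl.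
move: dx dy; rewrite -natr1 ler_norml => /andP[? ?] /andP[? ?]; lra.
Qed.

(** After scaling by [B ^+ n], the distance and the width of a cylinder account for 1 each. Hence a
    set of diameter at most [B ^- n] meets at most five cylinders of level [n]. *)
Lemma codes_far d d' x y n : codes d x -> codes d' y -> `|x - y| <= B ^- n ->
  (num (mkseq d' n) <= num (mkseq d n) + 2)%N.
Proof.
move=> /(_ n) /andP[_ dx] /(_ n) /andP[dy _].
rewrite -[leRHS]mul1r ler_pdivlMr ?bX_gt0 //.
rewrite -[X in `|_| * X](gtr0_norm (bX_gt0 n)) -normrM mulrBl ler_norml => /andP[h _].
rewrite -(ler_nat R) natrD; move: dx; rewrite -natr1; lra.
Qed.

(** A run of [0] keeps [x] near the left endpoint of its interval of level [k], a run of [b.-1] near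
    the right one. *)
Lemma codes_center d x (e : digit) k l :
  (sval e == 0 :> nat) || (sval e == b.-1 :> nat) -> (k <= l)%N ->
  (forall i, (k <= i < l)%N -> d i = e) -> codes d x ->
  exists p : nat, `|x - p%:R / B ^+ k| <= B ^- l.
Proof.
move=> e0 /subnKC kl de dx; set n := (l - k)%N in kl.
have sE : mkseq d l = mkseq d k ++ nseq n e.
  rewrite -kl mkseqD; congr (_ ++ _); apply: (@eq_from_nth _ e) => [|i].
    by rewrite size_mkseq size_nseq.
  rewrite size_mkseq => ilt; rewrite nth_mkseq // nth_nseq ilt de //; lia.
have numE : num (nseq n e) = 0%N \/ num (nseq n e) = (b ^ n).-1.
  case/orP: e0 => /eqP e0; [left|right]; elim: (n) => // m IH;
      rewrite -[nseq _ _]/([:: e] ++ nseq m e).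
    by rewrite num_cat IH addn0 /num /= mul0n add0n e0 mul0n.
  by rewrite num_cat IH size_nseq /num /= mul0n add0n e0 expnS; nia.
have := dx l; rewrite sE num_cat size_nseq => /andP[lo hi].
have key (p : nat) : `|x * B ^+ l - p%:R * B ^+ n| <= 1 ->
    `|x - p%:R / B ^+ k| <= B ^- l.
  move=> h; rewrite -[leRHS]mul1r ler_pdivlMr ?bX_gt0 //.
  rewrite -[X in `|_| * X](gtr0_norm (bX_gt0 l)) -normrM mulrBl.
  rewrite -{2}kl exprD mulrA divfK // gt_eqF //; exact: bX_gt0.
case: numE => nE; [exists (num (mkseq d k))|exists (num (mkseq d k)).+1]; apply: key.
  rewrite nE addn0 in lo hi; move: lo hi; rewrite -natr1 natrM natrX ler_norml.
  by move=> lo hi; apply/andP; split; lra.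
have bn0 : (0 < b ^ n)%N by rewrite expn_gt0; lia.
have nE' : (num (mkseq d k) * b ^ n + num (nseq n e)).+1 = ((num (mkseq d k)).+1 * b ^ n)%N.
  by rewrite nE; nia.
rewrite nE' in hi.
have : (num (mkseq d k) * b ^ n + num (nseq n e))%:R = ((num (mkseq d k)).+1 * b ^ n)%:R - 1 :> R.
  by rewrite -nE' -natr1 addrK.
move=> E; move: lo hi; rewrite E natrM natrX ler_norml => lo hi; apply/andP; split; lra.
Qed.

Definition cylinder w : set R := [set x | exists2 d, codes d x & mkseq d (size w) = w].

Lemma diam_cylinder w : (diam (cylinder w) <= (B ^- size w)%:E)%E.
Proof.
apply: diam_le => x y [d dx dw] [d' dy d'w].
by apply: (codes_close dx dy); rewrite dw d'w.
Qed.

Lemma cantor_words n x : cantor_set D x ->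
  exists2 w, w \in words [the finType of {: digit}] n & cylinder w x.
Proof.
move=> /cantorP[d dx]; exists (mkseq d n); first by rewrite mem_words size_mkseq.
by exists d; rewrite ?size_mkseq.
Qed.

End Coding.

(** * The convergence case *)

Section Approximation.
Variables (R : realType) (t : nat) (psi : nat -> R).
Hypothesis t_gt0 : (0 < t)%N.

Definition near_rational n : set R :=
  [set x | exists p : nat, `|x - p%:R / t%:R ^+ n| < psi n].

(** For each [n] only finitely many [p] qualify, as [x] is in [[0, 1]]. *)
Lemma W_setP x : W_set t psi x <->
  0 <= x <= 1 /\ forall m, exists2 n, (m <= n)%N & near_rational n x.
Proof.
have tX n : 0 < t%:R ^+ n :> R by rewrite exprn_gt0 // ltr0n.
split=> -[x01 hx]; split=> //.
  move=> m; apply: contrapT => nex; apply: hx.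
  pose P := (\max_(n < m) (Num.truncn (t%:R ^+ n * (1 + psi n) : R)).+1)%N.
  apply: (@sub_finite_set _ _ (`I_P `*` `I_m)); last exact: finite_setX.
  move=> [p n] /= h; have nm : (n < m)%N.
    by rewrite ltnNge; apply/negP => mn; apply: nex; exists n => //; exists p.
  split => //; apply: leq_trans (leq_bigmax (Ordinal nm)) => /=.
  rewrite ltnS truncn_ge_nat ?mulr_ge0 ?(ltW (tX n)) //; last first.
    by have := normr_ge0 (x - p%:R / t%:R ^+ n); lra.
  rewrite mulrC -ler_pdivrMr //; move: h x01; rewrite ltr_norml => /andP[h1 h2] /andP[h3 h4].
  by lra.
move=> /finite_seqP[s sE].
have [n mn [p h]] := hx (\max_(pn <- s) pn.2).+1.
have : [set` s] (p, n) by rewrite -sE.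
move=> /= ps; have := @leq_bigmax_seq _ s xpredT snd (p, n) ps isT.
by rewrite leqNgt mn.
Qed.

End Approximation.

Section Convergence.
Variables (R : realType) (b : nat) (D : {set 'I_b}) (t : nat).
Variables (f : R -> R) (psi : nat -> R) (gamma : R).
Hypotheses (b_gt1 : (1 < b)%N) (t_gt1 : (1 < t)%N) (D_gt0 : (0 < #|D|)%N).
Hypotheses (f_gt0 : forall r, 0 < r -> 0 < f r).
Hypotheses (f_mono : forall r s, 0 < r -> r <= s -> f r <= f s).
Hypotheses (psi_gt0 : forall n, 0 < psi n).
Hypotheses (gamma_ge0 : 0 <= gamma) (bgamma : b%:R `^ gamma = #|D|%:R).
Local Notation N := (#|D|%:R : R).
Local Notation B := (b%:R : R).
Local Notation T := (t%:R : R).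

Lemma powR_bX k : (B ^+ k) `^ gamma = N ^+ k.
Proof. by rewrite -powR_mulrn // -powRrM mulrC powRrM bgamma powR_mulrn. Qed.

Lemma powR_tX n : T `^ (n%:R * gamma) = (T ^+ n) `^ gamma.
Proof. by rewrite powRrM powR_mulrn. Qed.

Lemma powR_tX_ge1 n : 1 <= T `^ (n%:R * gamma).
Proof. by rewrite -[leLHS](powRr0 T) ler_powR ?mulr_ge0 // ler1n ltnW. Qed.

(** The factor 6 counts three numerators per cylinder and two halves of each interval around a
    fraction; a half has diameter at most [psi n], so that its cost is at most [f (psi n)]. *)
Lemma content_near_rational n k delta : psi n <= delta -> (t ^ n <= b ^ k)%N ->
  (hausdorff_content f delta (near_rational t psi n `&` cantor_set D)
     <= (6 * N ^+ k * f (psi n))%:E)%E.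
Proof.
move=> pd tb; set rho := psi n.
have t0 : 0 < T ^+ n by rewrite exprn_gt0 // ltr0n; lia.
have b0 := bX_gt0 R b_gt1 k.
have tbV : B ^- k <= T ^- n by rewrite lef_pV2 ?posrE // -!natrX ler_nat.
pose hs : seq (nat * bool) := [:: (0, true); (0, false); (1, true); (1, false);
  (2, true); (2, false)]%N.
(* The last fraction up to the left endpoint of the cylinder has numerator [M w]. As the cylinder is
   no longer than [T ^- n], only [M w], [M w + 1] and [M w + 2] can be numerators of fractions
   closer than [T ^- n] to one of its points. *)
have /choice[M hM] : forall w : seq (digit D), exists M,
    (M * b ^ k <= t ^ n * num w)%N && (t ^ n * num w < M.+1 * b ^ k)%N.
  move=> w; exists ((t ^ n * num w) %/ b ^ k)%N.
  by rewrite leq_trunc_div ltn_ceil // expn_gt0 ltnW.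
pose p (w : seq (digit D)) j : R := (M w + j)%N%:R / T ^+ n.
pose U (wh : seq (digit D) * (nat * bool)) : set R :=
  if T ^- n <= rho then cylinder wh.1 else
  [set x | if wh.2.2 then 0 <= x - p wh.1 wh.2.1 <= rho
           else - rho <= x - p wh.1 wh.2.1 <= 0].
pose s := [seq (w, h) | w <- words (digit D) k, h <- hs].
have sz : 6 * N ^+ k = (size s)%:R.
  by rewrite size_allpairs size_words card_digit natrM natrX mulrC.
rewrite sz; apply: (@hausdorff_content_seq _ f f_gt0 f_mono _ s U) => //.
- exact: psi_gt0.
- move=> [w h] /allpairsP[[w' h'] /= [wk _ [-> _]]]; rewrite /U.
  move: wk; rewrite mem_words => /eqP wk; case: ifPn => [trho|_].
    apply: (le_trans (diam_cylinder R b_gt1 _)).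
    by rewrite lee_fin /= wk (le_trans tbV).
  apply: diam_le => x y /=; rewrite ler_norml.
  by case: h.2 => /andP[? ?] /andP[? ?]; apply/andP; split; lra.
move=> x [[q xq]] /(cantor_words b_gt1 k)[w wk wx].
case: (leP (T ^- n) rho) => [trho|rhot].
  exists (w, (0, true)%N); first by apply: allpairs_f => //; rewrite inE.
  by rewrite /U trho.
have /andP[Mlo Mhi] := hM w.
have [j jle qE] : exists2 j, (j <= 2)%N & q = (M w + j)%N.
  move: wk wx; rewrite mem_words => /eqP wk [d /(_ k) dx dw].
  rewrite wk in dw; rewrite dw in dx; move: dx => /andP[lo hi].
  have : `|x * T ^+ n - q%:R| < 1.
    have -> : x * T ^+ n - q%:R = (x - q%:R / T ^+ n) * T ^+ n.
      by rewrite mulrBl divfK // gt_eqF.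
    by rewrite normrM (gtr0_norm t0) -ltr_pdivlMr // mul1r (lt_trans xq).
  rewrite ltr_norml => /andP[qlo qhi].
  move: Mlo; rewrite -(ler_nat R) !natrM !natrX => Mlo.
  move: Mhi; rewrite -(ltr_nat R) !natrM !natrX -natr1 => Mhi.
  have tbR : T ^+ n <= B ^+ k by rewrite -!natrX ler_nat.
  have Xlo : (M w)%:R <= x * T ^+ n.
    rewrite -(ler_pM2r b0) (le_trans Mlo) // mulrAC mulrC ler_wpM2r ?(ltW t0) //.
  have Xhi : x * T ^+ n <= (M w)%:R + 2.
    rewrite -(ler_pM2r b0) mulrAC.
    have : x * B ^+ k * T ^+ n <= (num w).+1%:R * T ^+ n by rewrite ler_wpM2r // ltW.
    by rewrite -natr1; lra.
  have Mq : (M w <= q)%N.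
    rewrite -ltnS -(ltr_nat R) -natr1; lra.
  have qM : (q < M w + 3)%N.
    rewrite -(ltr_nat R) natrD; lra.
  exists (q - M w)%N; last by rewrite subnKC.
  by rewrite leq_subLR -ltnS -addnS.
have pE : p w j = q%:R / T ^+ n by rewrite /p -qE.
have jhs c : (j, c) \in hs by move: jle; case: j {qE pE} => [|[|[|]]] //; case: c.
exists (w, (j, 0 <= x - p w j)); first by apply: allpairs_f.
rewrite /U /= leNgt rhot /= pE; move: xq; rewrite ltr_norml => /andP[? ?].
by case: leP => h; apply/andP; split => //; exact: ltW.
Qed.

(** For the least [k], if positive, [b ^ k.-1 < t ^ n]; raising to the power [gamma] loses only one
    factor [N]. *)
Lemma le_powR_tX n : exists2 k, (t ^ n <= b ^ k)%N & N ^+ k <= N * T `^ (n%:R * gamma).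
Proof.
have exk : exists k, (t ^ n <= b ^ k)%N by exists (t ^ n)%N; rewrite ltnW // ltn_expl.
have N1 : 1 <= N by rewrite ler1n.
case: (ex_minnP exk) => k tbk kmin; exists k => //; case: k tbk kmin => [|k] tbk kmin.
  by rewrite expr0 (le_trans N1) // ler_peMr // powR_tX_ge1.
rewrite exprS ler_wpM2l // powR_tX -powR_bX ge0_ler_powR ?nnegrE ?exprn_ge0 //.
rewrite -!natrX ler_nat ltnW // ltnNge; apply/negP => /kmin; lia.
Qed.

Lemma hausdorff_convergence :
  (\sum_(1 <= n <oo) (f (psi n) * T `^ (n%:R * gamma))%:E < +oo)%E ->
  hausdorff_measure f (W_set t psi `&` cantor_set D) = 0%E.
Proof.
pose u n := f (psi n) * T `^ (n%:R * gamma).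
rewrite -[X in (X < _)%E -> _]/(\sum_(1 <= n <oo) (u n)%:E)%E => S1.
have N0 : 0 < N by rewrite ltr0n.
have u0 n : 0 <= u n by rewrite mulr_ge0 ?powR_ge0 // ltW // f_gt0.
have S0 : (\sum_(n <oo) (u n)%:E < +oo)%E.
  rewrite (nneseries_split _ 1) => [|k _]; last by rewrite lee_fin.
  by rewrite add0n lte_add_pinfty // sumEFin ltry.
apply: hausdorff_measure_eq0 => // delta e d0 e0.
(* The bound [f delta] on the terms forces [psi n <= delta]; the other bound controls the cost of
   the cover. *)
pose c := Num.min (f delta) (e / (6 * N)).
have c0 : 0 < c by rewrite lt_min f_gt0 //= divr_gt0 // mulr_gt0.
have [m mc] : exists m, (\sum_(m <= n <oo) (u n)%:E < c%:E)%E.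
  have := nneseries_tail_cvg S0 (fun n _ => u0 n : (0 <= (u n)%:E)%E).
  move=> /fine_cvgP[fin /cvgrPdist_lt /(_ c c0) lt].
  have [m _ hm] : \forall m \near \oo, (\sum_(m <= n <oo) (u n)%:E < c%:E)%E.
    near=> m; have finm : (\sum_(m <= n <oo) (u n)%:E)%E \is a fin_num by near: m.
    rewrite -(fineK finm) lte_fin; have : `|0 - fine (\sum_(m <= n <oo) (u n)%:E)%E| < c by near: m.
    by rewrite sub0r normrN; apply: le_lt_trans; exact: ler_norm.
  by exists m; apply: hm => /=.
have um n : (m <= n)%N -> u n < c.
  move=> mn; rewrite -lte_fin (le_lt_trans _ mc) //.
  rewrite (nneseries_split _ (n - m).+1) => [|k _]; last by rewrite lee_fin.
  rewrite addnS subnKC // big_nat_recr //= -addeA addeCA leeDl // adde_ge0 //.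
    by rewrite sume_ge0 // => k _; rewrite lee_fin.
  by apply: nneseries_ge0 => k _ _; rewrite lee_fin.
have psid n : (m <= n)%N -> psi n <= delta.
  move=> /um; rewrite lt_min => /andP[un _]; rewrite leNgt; apply/negP => dn.
  have := f_mono d0 (ltW dn); rewrite leNgt (le_lt_trans _ un) //.
  by rewrite ler_peMr ?powR_tX_ge1 // ltW // f_gt0.
pose A n := near_rational t psi (n + m) `&` cantor_set D.
have sub : W_set t psi `&` cantor_set D `<=` \bigcup_n A n.
  move=> x [Wx Cx]; have [_ /(_ m)[n mn nx]] := (W_setP psi (ltnW t_gt1) x).1 Wx.
  by exists (n - m)%N => //; rewrite /A subnK.
rewrite (le_trans (hausdorff_content_mono f delta sub)) //.
apply: (le_trans (hausdorff_content_bigcup f_gt0 (x := fun n => 6 * N * u (n + m)%N) _)).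
  move=> n; have [k tbk Nk] := le_powR_tX (n + m).
  rewrite (le_trans (content_near_rational _ tbk)) ?psid ?leq_addl // lee_fin.
  rewrite /u -!mulrA ler_wpM2l // [leRHS]mulrCA [leLHS]mulrC ler_wpM2l //.
  by rewrite ltW // f_gt0.
under eq_eseriesr do rewrite EFinM.
rewrite nneseriesZl; last by move=> n _; rewrite lee_fin.
rewrite (nneseries_addn (f := fun n => (u n)%:E)); last by move=> n; rewrite lee_fin.
have -> : e = 6 * N * (e / (6 * N)) by rewrite mulrC divfK // gt_eqF // mulr_gt0.
rewrite [leRHS]EFinM lee_pmul2l ?lte_fin ?mulr_gt0 //.
by rewrite (le_trans (ltW mc)) // lee_fin ge_min lexx orbT.
Unshelve. all: by end_near. Qed.

End Convergence.

(** * The divergence case *)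

Section Divergence.
Variables (R : realType) (b : nat) (D : {set 'I_b}).
Variables (f : R -> R) (a e : digit D) (K : pred nat) (l : nat -> nat).
Hypotheses (b_gt1 : (1 < b)%N) (ae : a != e).
Hypotheses (f_gt0 : forall r, 0 < r -> 0 < f r).
Hypotheses (f_mono : forall r s, 0 < r -> r <= s -> f r <= f s).
Hypothesis l_ge : forall k, K k -> (k <= l k)%N.
Local Notation N := (#|D|%:R : R).
Local Notation B := (b%:R : R).
Local Notation F m := (f (B ^- m)).

Hypothesis lK : diverges (fun k => if K k then F (l k) * N ^+ k else 0).

Definition eventful (d : nat -> digit D) := forall n, exists k,
  [/\ (n <= k)%N, K k & forall i, (k <= i < l k)%N -> d i = e].

Let bV_gt0 m : 0 < B ^- m. Proof. by rewrite invr_gt0 bX_gt0. Qed.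
Let F_gt0 m : 0 < F m. Proof. exact: f_gt0. Qed.
Let D_gt0 : (0 < #|{: digit D}|)%N. Proof. by apply/card_gt0P; exists a. Qed.
Let N_gt0 : 0 < N. Proof. by rewrite -card_digit ltr0n. Qed.

Lemma bV_small delta : 0 < delta -> exists m, forall n, (m <= n)%N -> B ^- n <= delta.
Proof.
move=> d0; have := @cvg_bXV R b b_gt1; move=> /cvgrPdist_lt /(_ delta d0)[m _ hm].
exists m => n /hm /=; rewrite sub0r normrN => /ltW; apply: le_trans; exact: ler_norm.
Qed.

Lemma hausdorff_cantor_eq0 : (forall c, 0 < c -> exists m, forall n, (m <= n)%N -> F n * N ^+ n <= c) ->
  hausdorff_measure f (cantor_set D) = 0%E.
Proof.
move=> g0; apply: hausdorff_measure_eq0 => // delta c d0 c0.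
have [m1 h1] := g0 c c0; have [m2 h2] := bV_small d0.
pose m := maxn m1 m2.
apply: (le_trans (hausdorff_content_seq (U := @cylinder R b D) f_gt0 f_mono
  (bV_gt0 m) (h2 m (leq_maxr _ _)) (s := words (digit D) m) _ _)).
- move=> w; rewrite mem_words => /eqP <-; exact: diam_cylinder.
- exact: cantor_words.
by rewrite size_words card_digit natrX lee_fin mulrC h1 // leq_maxl.
Qed.

(** * Points without late patterns, for [F m * N ^+ m] bounded *)

Section Comparable.
Variable c2 : R.
Hypothesis c2_gt0 : 0 < c2.
Hypothesis g_le : forall m, F m * N ^+ m <= c2.

Definition uneventful n0 : set R := [set x | exists2 d, codes d x &
  forall k, (n0 <= k)%N -> K k -> exists2 i, (k <= i < l k)%N & d i <> e].

(** The set is covered by the cylinders of level [J] whose words have no pattern. These form a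
    proportion [al] of all words and cost at most [c2 * al], which [alive_bound] makes small. *)
Lemma hausdorff_uneventful n0 : hausdorff_measure f (uneventful n0) = 0%E.
Proof.
apply: hausdorff_measure_eq0 => // delta eps d0 eps0.
(* The shift by one leaves position [k] to the letter [a], ahead of the run that starts at
   [k.+1]. *)
pose K' k := K k.+1 && (n0 <= k)%N.
pose c k := (l k.+1 - k.+1)%N.
have dw : diverges (weight R (digit D) K' c).
  have x0 k : 0 <= (if K k then F (l k) * N ^+ k else 0).
    by case: ifP => // _; rewrite mulr_ge0 ?exprn_ge0 // ltW.
  have c3 : 0 < (c2 * N)^-1 by rewrite invr_gt0 mulr_gt0.
  apply: (diverges_le (m := n0)) (diverges_scale c3 (diverges_shift 1 x0 lK)) => [k|k n0k].
    by rewrite /weight; case: ifP => // _; rewrite invr_ge0 exprn_ge0.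
  rewrite /weight /K' n0k andbT add1n card_digit; case: ifP => Kk; last by rewrite mulr0.
  have kl := l_ge Kk.
  rewrite invfM [N ^+ (c k).+1]exprS invfM [c2^-1 * _]mulrC -mulrA ler_wpM2l ?invr_ge0 //.
  by rewrite ler_pdivrMl // ler_pdivlMr ?exprn_gt0 // -mulrA -exprD /c subnKC // g_le.
have [n hn] := dw (c2 / eps); have [m hm] := bV_small d0.
pose J := maxn m (\max_(k < n) (k + (c k).+1)).
have hJ k : (k < n)%N -> K' k -> (k + (c k).+1 <= J)%N.
  by move=> kn _; rewrite leq_max (leq_bigmax (Ordinal kn)) orbT.
have := @alive_bound R _ D_gt0 a e K' c ae n J hJ.
set al := avg _ _ => alb.
have al0 : 0 <= al by apply: avg_ge0 => w; rewrite /alive.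
pose s := [seq w <- words (digit D) J | ~~ hit a e K' c n w].
have szs : (size s)%:R = N ^+ J * al.
  rewrite /al /avg card_digit mulrA mulfV ?mul1r ?gt_eqF ?exprn_gt0 //.
  rewrite size_filter -sum1_count natr_sum big_mkcond; apply: eq_bigr => w _.
  by rewrite /alive; case: hit.
apply: (le_trans (hausdorff_content_seq (U := @cylinder R b D) f_gt0 f_mono
  (bV_gt0 J) (hm J (leq_maxl _ _)) (s := s) _ _)).
- by move=> w; rewrite mem_filter mem_words => /andP[_ /eqP <-]; exact: diam_cylinder.
- move=> x [d dx nev]; exists (mkseq d J); last by exists d; rewrite ?size_mkseq.
  rewrite mem_filter mem_words size_mkseq eqxx andbT; apply/hasPn => k.
  rewrite mem_iota add0n => /andP[_ kn]; apply/negP => /andP[Kk /eqP pk].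
  have kJ := hJ k kn Kk; move: Kk => /andP[Kk n0k].
  have [i /andP[ki il]] := nev k.+1 (leq_trans n0k (leqnSn k)) Kk; apply.
  have := congr1 (fun w => nth e w (i - k)) pk.
  rewrite nth_take ?nth_drop; last by rewrite /c; lia.
  rewrite subnKC ?(ltnW ki) // nth_mkseq; last by rewrite /c in kJ; lia.
  move=> ->; have /prednK <- : (0 < i - k)%N by lia.
  by rewrite /= nth_nseq if_same.
rewrite szs lee_fin mulrAC; apply: (@le_trans _ _ (c2 * al)).
  by rewrite ler_wpM2r // mulrC.
have c2e : 0 < c2 / eps by rewrite divr_gt0.
have : c2 / eps * al <= 1.
  by apply: (le_trans (ler_wpM2r al0 hn)); apply: (le_trans alb); lra.
by rewrite mulrAC ler_pdivrMr // mul1r.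
Qed.

Lemma hausdorff_comparable (E : set R) :
  (forall d x, eventful d -> codes d x -> E x) -> E `<=` cantor_set D ->
  hausdorff_measure f E = hausdorff_measure f (cantor_set D).
Proof.
move=> hE EC; apply/eqP; rewrite eq_le hausdorff_measure_mono //=.
apply: (@le_trans _ _ (hausdorff_measure f (E `|` \bigcup_n uneventful n))).
  apply: hausdorff_measure_mono => x /(cantorP D b_gt1)[d dx].
  have [ev|/existsNP[n nev]] := pselect (eventful d); [by left; exact: hE ev dx|right].
 exists n => //; exists d => // k nk Kk.
  apply: contrapT => h; apply: nev; exists k; split => // i il.
  by apply: contrapT => di; apply: h; exists i.
apply: hausdorff_measure_setU0 => //.
by apply: hausdorff_measure_bigcup0 => // n; exact: hausdorff_uneventful.
Qed.

End Comparable.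

(** * Infinite measure, for [F m * N ^+ m] nondecreasing and unbounded *)

Section Unbounded.
Hypothesis g_inc : forall m n, (m <= n)%N -> F m * N ^+ m <= F n * N ^+ n.
Hypothesis g_unbounded : forall x, exists m, x <= F m * N ^+ m.
Hypothesis f_lim0 : forall x, 0 < x -> exists m, forall n, (m <= n)%N -> F n <= x.

(** A finite measure would give a cover of finite cost. Replacing each of its sets by at most five
    cylinders multiplies the cost by at most [5 * N], up to a summable error, and
    [symbolic_mass_transference] yields a point of [E] that is not covered. *)
Lemma hausdorff_unbounded (E : set R) :
  (forall d x, eventful d -> codes d x -> E x) -> hausdorff_measure f E = +oo%E.
Proof.
move=> hE; apply/eqP; rewrite -leye_eq leNgt; apply/negP => Hfin.
pose h := fine (hausdorff_measure f E).
have hH : hausdorff_measure f E = h%:E.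
  rewrite fineK // ge0_fin_numE //.
  exact: le_trans (hausdorff_content_ge0 f_gt0 1 E) (hausdorff_content_le_measure _ _ _).
(* The cover costs less than [h + 1], the errors [1 / 2 ^ i.+1] add up to 1, and one more unit makes
   the inequality strict. *)
pose L := 5 * N * (h + 1) + 2.
have h0 : 0 <= h.
  rewrite -lee_fin -hH.
  exact: le_trans (hausdorff_content_ge0 f_gt0 1 E) (hausdorff_content_le_measure _ _ _).
have L0 : 0 < L by apply: ltr_wpDl => //; rewrite !mulr_ge0 // addr_ge0.
have [M ML] := g_unbounded L.
have /ereal_inf_lt[_ [U [dU EU] <-] cU] :
    (hausdorff_content f (B ^- M) E < (h + 1)%:E)%E.
  rewrite (le_lt_trans (hausdorff_content_le_measure _ _ (bV_gt0 M))) // hH lte_fin.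
  by rewrite ltrDl.
have /choice[m hm] : forall i, exists m, [/\ (M <= m)%N, (diam (U i) <= (B ^- m)%:E)%E &
    5 * F m <= 5 * N * cover_cost f (U i) + 1 / (2 ^ i.+1)%:R].
  move=> i; have ei : 0 < 1 / (2 ^ i.+1)%:R :> R by rewrite divr_gt0 // ltr0n expn_gt0.
  have [m0 hm0] := f_lim0 (divr_gt0 ei (ltr0Sn R 4)).
  have ci := cover_cost_ge0 f_gt0 (dU i).
  (* A set that is empty or of diameter 0 costs nothing; its level is taken so deep that the error
     term pays for five cylinders. *)
  case Ed : (diam (U i)) (dU i) => [r||] // rM; last first.
    exists (maxn M m0); split; rewrite ?leq_maxl ?leNye //.
    apply: ler_wpDl; first by rewrite mulr_ge0 // mulr_ge0.
    by rewrite mulrC -ler_pdivlMr // hm0 // leq_maxr.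
  rewrite lee_fin in rM; have [r0|r0] := ltP 0 r; last first.
    exists (maxn M m0); split; rewrite ?leq_maxl // ?lee_fin.
      by rewrite (le_trans r0) // ltW.
    apply: ler_wpDl; first by rewrite mulr_ge0 // mulr_ge0.
    by rewrite mulrC -ler_pdivlMr // hm0 // leq_maxr.
  have exm : exists m, B ^- m < r.
    have [m hm] := bV_small (divr_gt0 r0 (ltr0Sn R 1)).
    by exists m; rewrite (le_lt_trans (hm m (leqnn m))) //; lra.
  case: (ex_minnP exm) => -[|m] mr mmin.
    have : B ^- M <= B ^- 0.
      by rewrite lef_pV2 ?posrE ?bX_gt0 // ler_weXn2l // ler1n ltnW.
    by move: rM mr; lra.
  have rm : r <= B ^- m by rewrite leNgt; apply/negP => /mmin; rewrite ltnn.
  have Mm : (M <= m)%N.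
    rewrite leqNgt; apply/negP => mM; move: mr rM.
    have : B ^- M <= B ^- m.+1.
      by rewrite lef_pV2 ?posrE ?bX_gt0 // ler_weXn2l // ler1n ltnW.
    lra.
  exists m; split => //; rewrite ler_wpDr ?(ltW ei) // -mulrA ler_pM2l //.
  rewrite /cover_cost Ed lte_fin r0 /=.
  (* This gives [F m <= N * F m.+1], while [B ^- m.+1 < r]. *)
  have := g_inc (leqnSn m); rewrite [N ^+ m.+1]exprS mulrA ler_pM2r ?exprn_gt0 // => /le_trans; apply.
  by rewrite mulrC ler_pM2l // f_mono // ltW.
pose V i := [seq w <- words (digit D) (m i) |
  `[< exists d x, [/\ codes d x, U i x & mkseq d (m i) = w] >]].
have szV i : (size (V i) <= 5)%N.
  case EV : (V i) => [//|w0 s]; rewrite -EV.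
  have inV w : w \in V i -> exists d x, [/\ codes d x, U i x & mkseq d (m i) = w].
    by rewrite mem_filter => /andP[/asboolP].
  have szw w : w \in V i -> size w = m i.
    by rewrite mem_filter mem_words => /andP[_ /eqP].
  have far w w' : w \in V i -> w' \in V i -> (num w' <= num w + 2)%N.
    move=> /inV[d [x [dx Ux <-]]] /inV[d' [y [dy Uy <-]]].
    by apply: (codes_far b_gt1 dx dy); have [_ dm _] := hm i; exact: (le_diam dm).
  have w0V : w0 \in V i by rewrite EV mem_head.
  rewrite -(size_map (@num b D)) -(size_iota (num w0 - 2) 5); apply: uniq_leq_size.
    rewrite map_inj_in_uniq ?filter_uniq ?uniq_words // => w w' wV w'V.
    by apply: num_inj => //; rewrite !szw.
  move=> _ /mapP[w wV ->]; rewrite mem_iota.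
  have := far w0 w w0V wV; have := far w w0 wV w0V; lia.
have Vsz i u : u \in V i -> size u = m i.
  by rewrite mem_filter mem_words => /andP[_ /eqP].
have c0 i : 0 <= cover_cost f (U i) := cover_cost_ge0 f_gt0 (dU i).
have cost : (\sum_(i <oo) (\sum_(u <- V i) F (size u))%:E < L%:E)%E.
  apply: (@le_lt_trans _ _ (\sum_(i <oo) (5 * N * cover_cost f (U i))%:E + 1%:E)%E).
    apply: le_trans (epsilon_trick _ _ ler01); last first.
      by move=> i; rewrite lee_fin mulr_ge0 // mulr_ge0.
    apply: lee_nneseries => i _.
      by move=> _; rewrite lee_fin sumr_ge0 // => u _; exact: ltW.
    have [_ _ hmi] := hm i; rewrite -EFinD lee_fin (le_trans _ hmi) //.
    rewrite big_seq (eq_bigr (fun=> F (m i))); last by move=> u /Vsz ->.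
    by rewrite -big_seq big_const_seq count_predT iter_addr_0 -[_ *+ size _]mulr_natl ler_wpM2r ?ler_nat // ltW.
  under eq_eseriesr do rewrite EFinM.
  rewrite nneseriesZl; last by move=> i _; rewrite lee_fin.
  rewrite (@le_lt_trans _ _ ((5 * N)%:E * (h + 1)%:E + 1%:E)%E) //.
    by rewrite leeD2r // lee_pmul2l ?lte_fin ?mulr_gt0 // ltW.
  by rewrite -EFinM -EFinD lte_fin ltrD2l ltr1n.
have cardD : #|{: digit D}|%:R = N by rewrite card_digit.
have := @symbolic_mass_transference R (digit D) a e (fun m => F m) V K l ae F_gt0.
rewrite cardD => /(_ _ g_inc g_unbounded l_ge lK L cost L0)[].
- move=> p q pq; apply: f_mono => //.
  by rewrite lef_pV2 ?posrE ?bX_gt0 // ler_weXn2l // ler1n ltnW.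
- move=> i u /Vsz ->; rewrite (le_trans ML) // g_inc //; by have [] := hm i.
move=> d [dV dE]; have [x dx] := codes_exists R b_gt1 d.
have [i _ Uix] := EU x (hE d x dE dx).
apply: (dV i (mkseq d (m i))); last by rewrite size_mkseq.
rewrite mem_filter mem_words size_mkseq eqxx andbT; apply/asboolP.
by exists d, x.
Qed.

End Unbounded.

End Divergence.

(** * From denominators [t ^ n] to levels in base [b] *)

Section Reduction.
Variable R : realType.

Lemma multiplicatively_dependent b t : (1 < b)%N -> (1 < t)%N ->
  (exists q : rat, ln (t%:R : R) / ln (b%:R : R) = ratr q) ->
  exists p q, [/\ (0 < p)%N, (0 < q)%N & (t ^ q = b ^ p)%N].
Proof.
move=> b1 t1 [r rE].
have lnb : 0 < ln (b%:R : R) by rewrite ln_gt0 // ltr1n.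
have lnt : 0 < ln (t%:R : R) by rewrite ln_gt0 // ltr1n.
have r0 : 0 < r by rewrite -(ltr0q R) -rE divr_gt0.
have den0 := denq_gt0 r; have num0 : 0 < numq r by rewrite numq_gt0.
exists `|numq r|%N, `|denq r|%N; rewrite !absz_gt0 !gt_eqF //; split => //.
have dR : (`|denq r|%N)%:R = (denq r)%:~R :> R by rewrite natr_absz gtr0_norm.
have nR : (`|numq r|%N)%:R = (numq r)%:~R :> R by rewrite natr_absz gtr0_norm.
apply/eqP; rewrite -(eqr_nat R) !natrX; apply/eqP/ln_inj.
- by rewrite posrE exprn_gt0 // ltr0n; lia.
- by rewrite posrE exprn_gt0 // ltr0n; lia.
rewrite !lnXn ?ltr0n; try lia.
rewrite -[LHS]mulr_natl -[RHS]mulr_natl dR nR.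
have d0 : (denq r)%:~R != 0 :> R by rewrite intr_eq0 gt_eqF.
move: rE; rewrite /ratr => /(canRL (divfK (lt0r_neq0 lnb))) ->.
by field.
Qed.

Lemma nneseries_diverges (x : nat -> R) : (forall n, 0 <= x n) ->
  (\sum_(1 <= n <oo) (x n)%:E)%E = +oo%E -> diverges x.
Proof.
move=> x0 S B; apply: contrapT => /forallNP h.
suff : (\sum_(1 <= n <oo) (x n)%:E <= B%:E)%E by rewrite S.
apply: lime_le; first by apply: is_cvg_nneseries => n _ _; rewrite lee_fin.
apply: nearW => n; rewrite sumEFin lee_fin.
apply: (@le_trans _ _ (\sum_(0 <= k < n) x k)).
  by case: n => [|n]; [rewrite !big_geq|rewrite [leRHS]big_ltn // lerDr].
by rewrite ltW // ltNge; apply/negP; exact: h.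
Qed.

Lemma sum_blocks q (x : nat -> R) M : \sum_(0 <= m < M) \sum_(0 <= r < q) x (m * q + r)%N =
  \sum_(0 <= k < M * q) x k.
Proof.
elim: M => [|M IH]; first by rewrite !big_geq.
rewrite big_nat_recr //= IH mulSnr [RHS](big_cat_nat (leq0n (M * q)) (leq_addr _ _)) /=.
congr (_ + _); apply/esym; rewrite -[X in \sum_(X <= _ < _) _]add0n big_addn addKn.
by apply: eq_bigr => r _; rewrite addnC.
Qed.

Lemma diverges_blocks q (x : nat -> R) : (0 < q)%N -> (forall n, 0 <= x n) -> diverges x ->
  diverges (fun m => \sum_(0 <= r < q) x (m * q + r)%N).
Proof.
move=> q0 x0 dx B; have [n Bn] := dx B; exists n; rewrite sum_blocks (le_trans Bn) //.
by rewrite [leRHS](big_cat_nat (leq0n n) (leq_pmulr n q0)) /= lerDl sumr_ge0.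
Qed.

Lemma diverges_sparse p (x : nat -> R) : (0 < p)%N -> (forall n, 0 <= x n) -> diverges x ->
  diverges (fun k => if (p %| k)%N then x (k %/ p)%N else 0).
Proof.
move=> p0 x0 dx B; have [n Bn] := dx B; exists (n * p)%N; rewrite (le_trans Bn) //.
rewrite -sum_blocks; apply: ler_sum => m _.
rewrite big_ltn // addn0 dvdn_mull // mulnK // lerDl sumr_ge0 // => r _.
by case: ifP.
Qed.

Variables (b : nat) (D : {set 'I_b}) (t p q r : nat).
Variables (f : R -> R) (psi : nat -> R) (gamma : R).
Hypotheses (b_gt1 : (1 < b)%N) (t_gt1 : (1 < t)%N) (D_gt0 : (0 < #|D|)%N).
Hypotheses (p_gt0 : (0 < p)%N) (q_gt0 : (0 < q)%N) (tqbp : (t ^ q = b ^ p)%N).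
Hypotheses (f_gt0 : forall r, 0 < r -> 0 < f r).
Hypotheses (f_mono : forall r s, 0 < r -> r <= s -> f r <= f s).
Hypotheses (psi_gt0 : forall n, 0 < psi n).
Hypothesis bgamma : b%:R `^ gamma = #|D|%:R.
Local Notation N := (#|D|%:R : R).
Local Notation B := (b%:R : R).
Local Notation T := (t%:R : R).
Local Notation F m := (f (B ^- m)).

(** The exponent of [t] attached to a level [k] divisible by [p]; multiples of [B ^- k] are
    fractions with denominator [t ^ denominator k]. *)
Definition denominator k := ((k %/ p) * q + r)%N.

Lemma t_denominator k : (p %| k)%N -> (t ^ denominator k = b ^ k * t ^ r)%N.
Proof using tqbp.
move=> pk; rewrite /denominator expnD [(k %/ p * q)%N]mulnC.
by rewrite expnM tqbp -expnM [(p * _)%N]mulnC divnK.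
Qed.

(** The last clause expresses that [l] is least among the exponents from [k] on that satisfy the
    second. *)
Definition level k (l : nat) := [/\ (k <= l)%N, B ^- l < psi (denominator k) &
  l = k \/ psi (denominator k) <= B ^- l.-1].

Lemma level_exists k : exists l, level k l.
Proof using b_gt1 psi_gt0.
have exl : exists l, (k <= l)%N && (B ^- l < psi (denominator k)).
  have [m hm] := bV_small b_gt1 (divr_gt0 (psi_gt0 (denominator k)) (ltr0Sn R 1)).
  exists (maxn k m); rewrite leq_maxl /= (le_lt_trans (hm _ (leq_maxr k m))) //.
  by rewrite ltr_pdivrMr // mulr_natr mulr2n ltrDl.
case: (ex_minnP exl) => l /andP[kl lpsi] lmin; exists l; split => //.
have [lk|kl'] := leqP l k; first by left; apply/eqP; rewrite eqn_leq lk.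
right; rewrite leNgt; apply/negP => h.
by have := lmin l.-1; rewrite h andbT; clear -kl'; lia.
Qed.

(** If [l k = k], the term is at least [c1]. Otherwise [psi] is at most [B ^- (l k).-1], so that [f]
    of it is at most [C * F (l k)]; and [T] to the power [denominator k * gamma] is [N ^+ k] up to
    the constant [Tr]. *)
Lemma level_diverges (c1 C : R) l : 0 < c1 -> 0 < C ->
  (forall m, c1 <= F m * N ^+ m) -> (forall m, F m <= C * F m.+1) ->
  (forall k, level k (l k)) ->
  diverges (fun m => f (psi (m * q + r)%N) * T `^ ((m * q + r)%:R * gamma)) ->
  diverges (fun k => if (p %| k)%N then F (l k) * N ^+ k else 0).
Proof using b_gt1 t_gt1 D_gt0 p_gt0 tqbp f_gt0 f_mono psi_gt0 bgamma.
move=> c10 C0 gc FC hl dx; pose Tr := (T ^+ r) `^ gamma.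
have T0 : 0 < T by rewrite ltr0n ltnW.
have N0 : 0 < N by rewrite ltr0n.
have Tr0 : 0 < Tr by rewrite powR_gt0 // exprn_gt0.
have CT : 0 < (C * Tr)^-1 by rewrite invr_gt0 mulr_gt0.
have bV m : 0 < B ^- m by rewrite invr_gt0 bX_gt0.
have x0 m : 0 <= f (psi (m * q + r)%N) * T `^ ((m * q + r)%:R * gamma).
  by rewrite mulr_ge0 ?powR_ge0 // ltW // f_gt0.
have := diverges_scale CT (diverges_sparse p_gt0 x0 dx).
set y := fun k => _ * _ => dy.
have y0 k : 0 <= y k by rewrite /y; case: ifP => _; rewrite ?mulr0 // mulr_ge0 // ltW.
apply: (diverges_le (m := 0)) (diverges_min c10 y0 dy) => k.
  by case: ifP => // _; rewrite mulr_ge0 ?exprn_ge0 // ltW // f_gt0.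
move=> _; rewrite /y; case: ifP => pk; last by rewrite mulr0 ge_min lexx orbT.
rewrite ge_min; have [kl _ [->|psil]] := hl k; first by rewrite gc.
case El : (l k == k); first by rewrite (eqP El) gc.
apply/orP; right; rewrite -/(denominator k) powR_tX -natrX t_denominator //.
rewrite natrM !natrX powRM ?exprn_ge0 // (powR_bX bgamma) -/Tr.
have -> : (C * Tr)^-1 * (f (psi (denominator k)) * (N ^+ k * Tr)) =
    C^-1 * f (psi (denominator k)) * N ^+ k.
  by field; rewrite !gt_eqF.
rewrite ler_wpM2r ?exprn_ge0 // ler_pdivrMl // (le_trans (f_mono _ psil)) //.
by rewrite (le_trans (FC _)) // prednK //; move/eqP: El; clear -kl; lia.
Qed.

(** A run of [e] brings [x] closer than [psi (denominator k)] to some [P / b ^ k], which equals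
    [P * t ^ r / t ^ denominator k]. *)
Lemma eventful_approx (e : digit D) l d x :
  (sval e == 0 :> nat) || (sval e == b.-1 :> nat) -> (forall k, level k (l k)) ->
  eventful e (fun k => p %| k)%N l d -> codes d x ->
  (W_set t psi `&` cantor_set D) x.
Proof using b_gt1 t_gt1 p_gt0 q_gt0 tqbp.
move=> e0 hl ev dx; split; last by apply/(cantorP D b_gt1); exists d.
apply/(W_setP psi (ltnW t_gt1) x); split=> [|m]; first exact: (codes01 dx).
have [k [mk pk de]] := ev (m * p)%N; exists (denominator k).
  have : (m <= k %/ p)%N by rewrite leq_divRL.
  rewrite /denominator => /leq_trans; apply.
  by rewrite (leq_trans (leq_pmulr _ q_gt0)) // leq_addr.
have [kl lpsi _] := hl k.
have [P hP] := codes_center b_gt1 e0 kl de dx.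
exists (P * t ^ r)%N; rewrite -natrX t_denominator // !natrM invfM.
rewrite mulrACA divff ?mulr1 ?natrX ?(le_lt_trans hP) //.
by rewrite expf_neq0 // pnatr_eq0 -lt0n ltnW.
Qed.

End Reduction.

Theorem theorem1p5 (R : realType) (b : nat) (D : {set 'I_b}) (t : nat)
    (f : R -> R) (psi : nat -> R) :
  (3 <= b)%N ->
  (2 <= #|D|)%N -> (#|D| <= b.-1)%N ->
  (exists2 i, i \in D & (nat_of_ord i == 0)%N || (nat_of_ord i == b.-1)%N) ->
  (2 <= t)%N ->
  (exists q : rat, ln (t%:R : R) / ln (b%:R : R) = ratr q) ->
  dimension_function f ->
  let gamma : R := ln (#|D|%:R : R) / ln (b%:R : R) in
  ((forall r s : R, 0 < r -> r <= s -> r `^ (- gamma) * f r <= s `^ (- gamma) * f s)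
   \/ (forall r s : R, 0 < r -> r <= s -> s `^ (- gamma) * f s <= r `^ (- gamma) * f r)) ->
  (forall n, 0 < psi n) ->
  let S := (\sum_(1 <= n <oo) (f (psi n) * (t%:R : R) `^ (n%:R * gamma))%:E)%E in
  ((S < +oo)%E ->
     hausdorff_measure f (W_set t psi `&` @cantor_set R b D) = 0%E) /\
  (S = +oo%E ->
     hausdorff_measure f (W_set t psi `&` @cantor_set R b D)
       = hausdorff_measure f (@cantor_set R b D)).
Proof.
move=> b3 D2 _ [e0 e0D e0P] t2 tb [_ f_mono f_gt0 f_lim] gamma g_mono psi0 S.
have b1 : (1 < b)%N by exact: ltnW.
have D1 : (0 < #|D|)%N by exact: ltnW.
pose e : digit D := exist _ e0 e0D.
have [a ae] : exists a : digit D, a != e.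
  have /card_gt1P[x [y [xD yD xy]]] := D2.
  have [xe|xe] := eqVneq x e0; last by exists (exist _ x xD).
  by exists (exist _ y yD); rewrite -val_eqE /= -xe eq_sym.
have lnb : 0 < ln (b%:R : R) by rewrite ln_gt0 // ltr1n.
have bgamma : b%:R `^ gamma = #|D|%:R :> R.
  by rewrite /powR pnatr_eq0 gtn_eqF ?(ltnW b1) // divfK ?gt_eqF // lnK // posrE ltr0n.
have gamma0 : 0 <= gamma by rewrite divr_ge0 ?(ltW lnb) // ln_ge0 // ler1n.
split; first exact: hausdorff_convergence.
move=> Soo.
have [p [q [p0 q0 tqbp]]] := multiplicatively_dependent b1 t2 tb.
have x0 n : 0 <= f (psi n) * t%:R `^ (n%:R * gamma).
  by rewrite mulr_ge0 ?powR_ge0 // ltW // f_gt0.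
have := diverges_blocks q0 x0 (nneseries_diverges x0 Soo).
(* Some residue [r] of the exponents modulo [q] already carries a divergent series. *)
move=> /(diverges_sum (fun r k => x0 (k * q + r)%N))[r _ dx].
have /choice[l hl] := level_exists p q r b1 psi0.
have l_ge k : (p %| k)%N -> (k <= l k)%N by move=> _; have [] := hl k.
set E := W_set t psi `&` cantor_set D.
have hE := eventful_approx b1 t2 p0 q0 tqbp (e := e) e0P hl.
pose g m := f (b%:R ^- m) * (#|D|%:R : R) ^+ m.
have bV0 m : 0 < b%:R ^- m :> R by rewrite invr_gt0 bX_gt0.
have bV_le m n : (m <= n)%N -> b%:R ^- n <= b%:R ^- m :> R.
  by move=> mn; rewrite lef_pV2 ?posrE ?bX_gt0 // ler_weXn2l // ler1n ltnW.
have N0 : 0 < #|D|%:R :> R by rewrite ltr0n.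
have g0 m : 0 < g m by rewrite mulr_gt0 ?exprn_gt0 // f_gt0.
have gE m : g m = (b%:R ^- m) `^ (- gamma) * f (b%:R ^- m).
  rewrite /g mulrC; congr (_ * _); rewrite powRN.
  have /(congr1 (fun z : R => z `^ gamma)) := mulVf (lt0r_neq0 (bX_gt0 R b1 m)).
  rewrite powRM ?(ltW (bV0 m)) ?(ltW (bX_gt0 R b1 m)) // (powR_bX bgamma) powR1.
  by move=> /(canRL (mulfK (lt0r_neq0 (exprn_gt0 m N0)))) ->; rewrite mul1r invrK.
have comparable c1 c2 : 0 < c1 -> (forall m, c1 <= g m <= c2) ->
    hausdorff_measure f E = hausdorff_measure f (cantor_set D).
  move=> c10 hg; have c20 : 0 < c2 by have /andP[_] := hg 0%N; exact: lt_le_trans.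
  (* From [g m <= c2] and [c1 <= g m.+1], this constant bounds the ratio of [f] at consecutive
     levels. *)
  have C0 : 0 < c2 * #|D|%:R / c1 by rewrite divr_gt0 // mulr_gt0.
  apply: (@hausdorff_comparable R b D f a e (fun k => p %| k)%N l b1 ae f_gt0 f_mono
    l_ge _ c2 c20).
  - apply: (level_diverges (gamma := gamma) b1 t2 D1 p0 tqbp f_gt0 f_mono psi0 bgamma c10 C0) dx => // m.
      by have /andP[] := hg m.
    have /andP[_ gm2] := hg m; have /andP[gm1 _] := hg m.+1.
    rewrite -(ler_pM2r (exprn_gt0 m N0)) (le_trans gm2) //.
    have -> : c2 * #|D|%:R / c1 * f (b%:R ^- m.+1) * #|D|%:R ^+ m = c2 / c1 * g m.+1.
      by rewrite /g [#|D|%:R ^+ m.+1]exprS; ring.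
    by rewrite mulrAC ler_pdivlMr // ler_pM2l.
  - by move=> m; have /andP[] := hg m.
  - exact: hE.
  - by move=> x [].
(* As [b ^- m] decreases with [m], the sequence [g] varies in the direction opposite to that of the
   function in the hypothesis. *)
have [g_dec|g_inc] := g_mono.
  have gd m n : (m <= n)%N -> g n <= g m by move=> mn; rewrite !gE g_dec // bV_le.
  have [[c c0 cg]|ng] := pselect (exists2 c, 0 < c & forall m, c <= g m).
    by apply: (comparable c (g 0%N)) => // m; rewrite cg gd.
  have C0 : hausdorff_measure f (cantor_set D) = 0%E.
    apply: (hausdorff_cantor_eq0 b1 f_gt0 f_mono) => c c0; apply: contrapT => nm.
    apply: ng; exists c => // m; rewrite leNgt; apply/negP => gm; apply: nm.
    by exists m => n mn; rewrite (le_trans (gd _ _ mn)) // ltW.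
  apply/eqP; rewrite eq_le hausdorff_measure_mono /=; last by move=> x [].
  rewrite C0; apply: (le_trans (hausdorff_content_ge0 f_gt0 1 E)).
  by apply: hausdorff_content_le_measure.
have gi m n : (m <= n)%N -> g m <= g n by move=> mn; rewrite !gE g_inc // bV_le.
have [[c cg]|ng] := pselect (exists c, forall m, g m <= c).
  by apply: (comparable (g 0%N) c) => // m; rewrite gi /=.
have Eoo : hausdorff_measure f E = +oo%E.
  apply: (@hausdorff_unbounded R b D f a e (fun k => p %| k)%N l b1 ae f_gt0 f_mono l_ge) => //.
  - apply: (level_diverges (gamma := gamma) b1 t2 D1 p0 tqbp f_gt0 f_mono psi0 bgamma (g0 0%N) N0) dx => // m.
      exact: gi.
    have := gi m m.+1 (leqnSn m); rewrite /g [#|D|%:R ^+ m.+1]exprS mulrA.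
    by rewrite ler_pM2r ?exprn_gt0 // mulrC.
  - move=> x; apply: contrapT => nx; apply: ng; exists x => m.
    by rewrite leNgt; apply/negP => gx; apply: nx; exists m; rewrite ltW.
  - move=> x x_gt0; have [d d0 hd] : exists2 d, 0 < d & forall s, 0 < s -> s < d -> f s <= x.
      move: f_lim => /cvgrPdist_lt /(_ x x_gt0)[d d0 hd]; exists d => // s s0 sd.
      have := hd s; rewrite /= !sub0r !normrN (gtr0_norm s0) => /(_ sd s0).
      by move=> /ltW; apply: le_trans; exact: ler_norm.
    have [m hm] := bV_small b1 (divr_gt0 d0 (ltr0Sn R 1)).
    exists m => n /hm h; apply: hd => //; rewrite (le_lt_trans h) //; lra.
apply/eqP; rewrite eq_le hausdorff_measure_mono /=; last by move=> x [].
by rewrite Eoo leey.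
Qed.
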